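(* Let $\mathcal A=\{a,b\}\subseteq\mathbb R$ be a binary alphabet and let $(\mathbb X,S)\subseteq\mathcal A^{\mathbb Z}$ be a simple Toeplitz subshift. Let $f_1:\mathbb X\to\mathbb R$ be locally constant with window size $1$, i.e. $f_1(x)=g(x_n)$ for some fixed $n\in\mathbb Z$ and $g:\mathcal A\to\mathbb R$, let $V_x(m)=f_1(S^mx)$ and $H_x=\Delta+V_x$, and let $V_{\mathrm{per}}:\mathbb Z\to\mathbb R$ be periodic with period $p$. If $(\mathbb Z_p,+1)$ is a factor of $(\mathbb X,S)$, then for every $x\in\mathbb X$ the operator $H_x+V_{\mathrm{per}}$ has no eigenvalues.
   Context: $\Delta$ is the discrete Laplacian $(\Delta\psi)(n)=\psi(n+1)+\psi(n-1)$; $S$ is the left shift. Simple Toeplitz subshift: given a coding sequence $s=(b_k,n_k)_{k\in\mathbb N}$ with $b_k\in\mathcal A$, $n_k\ge 2$, and $(b_k)$ not eventually constant, define words $\widetilde w_1=b_1$ and $\widetilde w_{k+1}=\widetilde w_k^{n_k}b_k^{-1}b_{k+1}$ (i.e. $\widetilde w_k^{n_k}$ with its last letter $b_k$ replaced by $b_{k+1}$). Each $\widetilde w_k$ is a prefix of $\widetilde w_{k+1}$, so they define a limit $x(s)\in\mathcal A^{\mathbb N}$; the simple Toeplitz subshift is $\mathbb X(s)=\{x\in\mathcal A^{\mathbb Z}: x_j\cdots x_k \text{ is a subword of } x(s) \text{ for all } j\le k\}$. $(\mathbb Z_p,+1)$ is a factor of $(\mathbb X,S)$ if there is a continuous surjection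 $\pi:\mathbb X\to\mathbb Z_p$ with $\pi(Sx)=\pi(x)+1 \bmod p$. *)

(* Defs.v *)
From Stdlib Require Import Reals ZArith List Lia.
From Coquelicot Require Import Coquelicot.
Import ListNotations.
Open Scope R_scope.

(** Coding sequence s = (b_k, n_k)_k, indexed from 0 (b 0 = b_1 of the paper). *)
Definition coding_ok (a b : R) (bk : nat -> R) (nk : nat -> nat) : Prop :=
  (forall k, bk k = a \/ bk k = b) /\
  (forall k, (2 <= nk k)%nat) /\
  ~ (exists K, forall k, (K <= k)%nat -> bk k = bk K).

Fixpoint toep_word (bk : nat -> R) (nk : nat -> nat) (k : nat) : list R :=
  match k with
  | O => [bk O]
  | S k' => removelast (concat (repeat (toep_word bk nk k') (nk k'))) ++ [bk k]
  end.

(** The one-sided limit x(s) in A^N: position i is read in the prefix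
    w~_{i+1} (which has length >= 2^i >= i+1). *)
Definition toep_limit (bk : nat -> R) (nk : nat -> nat) (i : nat) : R :=
  nth i (toep_word bk nk i) 0.

Definition toeplitz_subshift (bk : nat -> R) (nk : nat -> nat) (x : Z -> R) : Prop :=
  forall j k : Z, (j <= k)%Z ->
    exists m : nat, forall t : nat, (Z.of_nat t <= k - j)%Z ->
      x (j + Z.of_nat t)%Z = toep_limit bk nk (m + t).

Definition shiftZ (m : Z) (x : Z -> R) : Z -> R := fun k => x (k + m)%Z.

(** (Z_p,+1) is a (topological) factor of (X,S): a continuous surjection
    pi : X -> Z_p = {0,..,p-1} with pi(Sx) = pi(x)+1 mod p.  Continuity
    (product topology on A^Z, discrete Z_p) at x means pi is constant on a
    cylinder around x. *)
Definition Zp_factor (X : (Z -> R) -> Prop) (p : Z) : Prop :=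
  exists pi : (Z -> R) -> Z,
    (forall x, X x -> (0 <= pi x < p)%Z) /\
    (forall r, (0 <= r < p)%Z -> exists x, X x /\ pi x = r) /\
    (forall x, X x -> pi (shiftZ 1 x) = ((pi x + 1) mod p)%Z) /\
    (forall x, X x -> exists N : nat, forall y, X y ->
        (forall j : Z, (Z.abs j <= Z.of_nat N)%Z -> y j = x j) -> pi y = pi x).

Definition l2Z (psi : Z -> C) : Prop :=
  ex_series (fun n : nat => (Cmod (psi (Z.of_nat n)))^2) /\
  ex_series (fun n : nat => (Cmod (psi (- Z.of_nat n)%Z))^2).

Definition is_eigenvalue (W : Z -> R) (E : C) : Prop :=
  exists psi : Z -> C,
    l2Z psi /\ (exists n, psi n <> 0%C) /\
    forall n : Z,
      (psi (n + 1)%Z + psi (n - 1)%Z + RtoC (W n) * psi n = E * psi n)%C.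

(* Main.v *)
Require Import Defs.
From Stdlib Require Import Reals ZArith.
From Coquelicot Require Import Coquelicot.
From Stdlib Require Import List Lia Lra Classical ClassicalEpsilon FunctionalExtensionality.
Open Scope R_scope.

(** A point [x] of the subshift has holes at every level [k], forming a coset of [L_k Z];
    off them [x] is [L_k]-periodic, and the holes of level [k] that are not holes of level
    [k+1] carry the letter [b_k].  A cyclic factor of order [p] forces [p] to divide some
    [L_k], so from that level on the periodic potential sees all holes alike and the potential
    consists of blocks with only two transfer matrices per level, which differ in the hole.
    By Cayley-Hamilton, [psi (t + L_k) + psi (t - L_k) = tau psi t] whenever the two holes
    around [t] carry the same letter [e], where [tau] is the trace of the [e]-block.

    Let [psi t0 <> 0].  Gordon's argument leaves, for large [k], only few positions of
    [t0] in its block.  In the first scenario all steps are triplings and the traces along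
    them are square summable; then the difference of the two block traces stays away from 0
    although both tend to 0.  In the other, two consecutive levels have large traces, hence at
    one level both block traces exceed 3; the values of [psi] at the holes of that level
    are then convex in modulus, and cannot decay at both ends. *)

(** * Two-by-two complex matrices and trace identities *)

Record mat2 := Mat2 { m11 : C; m12 : C; m21 : C; m22 : C }.

Definition mmul (X Y : mat2) : mat2 :=
  (Mat2 (m11 X * m11 Y + m12 X * m21 Y) (m11 X * m12 Y + m12 X * m22 Y)
        (m21 X * m11 Y + m22 X * m21 Y) (m21 X * m12 Y + m22 X * m22 Y))%C.

Definition mone : mat2 := Mat2 1 0 0 1.
Definition mdet (X : mat2) : C := (m11 X * m22 X - m12 X * m21 X)%C.
Definition mtr (X : mat2) : C := (m11 X + m22 X)%C.
Definition tmat (z : C) : mat2 := Mat2 z (-(1))%C 1 0.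

Lemma mmul_assoc X Y Z : mmul X (mmul Y Z) = mmul (mmul X Y) Z.
Proof. unfold mmul; simpl; f_equal; ring. Qed.

Lemma mmul_1_l X : mmul mone X = X.
Proof. destruct X; unfold mmul, mone; simpl; f_equal; ring. Qed.

Lemma mmul_1_r X : mmul X mone = X.
Proof. destruct X; unfold mmul, mone; simpl; f_equal; ring. Qed.

Lemma mdet_mul X Y : mdet (mmul X Y) = (mdet X * mdet Y)%C.
Proof. unfold mdet, mmul; simpl; ring. Qed.

Lemma mdet_tmat z : mdet (tmat z) = 1%C.
Proof. unfold mdet, tmat; simpl; ring. Qed.

(** [tmat z] has determinant 1, so [X] and [Y] are conjugate. Three entries of the hypothesis
    suffice, without forming an inverse. *)
Lemma mtr_tmat_conj z X Y : mmul (tmat z) X = mmul Y (tmat z) -> mtr X = mtr Y.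
Proof.
intros H.
pose proof (f_equal m12 H) as H1; pose proof (f_equal m21 H) as H2.
pose proof (f_equal m22 H) as H3.
unfold mmul, tmat in H1, H2, H3; unfold mtr; cbn [m11 m12 m21 m22] in *.
transitivity ((1 * m11 X + 0 * m21 X) + z * (1 * m12 X + 0 * m22 X)
  - (z * m12 X + - (1) * m22 X))%C; [ring|].
rewrite H1, H2, H3; ring.
Qed.

Lemma mtr_tmat_mul z P : mtr (mmul (tmat z) P) = (z * m11 P + m12 P - m21 P)%C.
Proof. unfold mtr, mmul, tmat; simpl; ring. Qed.

(** With [A = tmat z P] and [B = tmat w P] this is tr(AB) = tr(A) tr(B) - tr(A B^-1); here A B^-1 is
    unipotent, of trace 2, because [P] cancels. *)
Lemma mtr_tmat_mul2 z w P : mdet P = 1%C ->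
  mtr (mmul (mmul (tmat z) P) (mmul (tmat w) P)) =
  (mtr (mmul (tmat w) P) * mtr (mmul (tmat z) P) - 2)%C.
Proof.
intros HP.
replace (2 : C)%C with (2 * mdet P)%C by (rewrite HP; ring).
destruct P as [p q r s]; unfold mtr, mmul, tmat, mdet; simpl; ring.
Qed.

Lemma mtr_cayley X A Y : mdet A = 1%C ->
  mtr (mmul X (mmul A (mmul A Y))) = (mtr A * mtr (mmul X (mmul A Y)) - mtr (mmul X Y))%C.
Proof.
intros HA.
replace (mtr (mmul X Y)) with (mdet A * mtr (mmul X Y))%C by (rewrite HA; ring).
destruct X, A, Y; unfold mtr, mmul, mdet; simpl; ring.
Qed.

(** * Transfer matrices and solutions of the difference equation *)

(** Transfer matrix over the sites [s+1, ..., s+m]; it sends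
    [(psi (s+1), psi s)] to [(psi (s+m+1), psi (s+m))]. *)
Fixpoint mon (v : Z -> C) (s : Z) (m : nat) : mat2 :=
  match m with
  | O => mone
  | S m' => mmul (tmat (v (s + Z.of_nat (S m'))%Z)) (mon v s m')
  end.

Definition solves (v psi : Z -> C) : Prop :=
  forall n, psi (n + 1)%Z = (v n * psi n - psi (n - 1)%Z)%C.

Lemma mdet_mon v s m : mdet (mon v s m) = 1%C.
Proof.
induction m as [|m IH]; [unfold mdet; simpl; ring|].
change (mdet (mmul (tmat (v (s + Z.of_nat (S m))%Z)) (mon v s m)) = 1%C).
rewrite mdet_mul, IH, mdet_tmat; ring.
Qed.

Lemma mon_ext v s s' m :
  (forall i, (1 <= i <= Z.of_nat m)%Z -> v (s + i)%Z = v (s' + i)%Z) ->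
  mon v s m = mon v s' m.
Proof.
induction m as [|m IH]; intros H; [reflexivity|].
cbn [mon]; rewrite IH by (intros; apply H; lia).
now rewrite (H (Z.of_nat (S m))) by lia.
Qed.

Lemma mon_add v s m m' :
  mon v s (m + m') = mmul (mon v (s + Z.of_nat m) m') (mon v s m).
Proof.
induction m' as [|m' IH].
- now rewrite Nat.add_0_r; simpl; rewrite mmul_1_l.
- rewrite Nat.add_succ_r; cbn [mon]; rewrite IH, mmul_assoc.
  do 4 f_equal; lia.
Qed.

Lemma mon_solves v psi s m : solves v psi ->
  psi (s + Z.of_nat m + 1)%Z =
    (m11 (mon v s m) * psi (s + 1)%Z + m12 (mon v s m) * psi s)%C /\
  psi (s + Z.of_nat m)%Z =
    (m21 (mon v s m) * psi (s + 1)%Z + m22 (mon v s m) * psi s)%C.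
Proof.
intros Hs; induction m as [|m [IH1 IH2]].
- simpl; rewrite Z.add_0_r; split; ring.
- replace (s + Z.of_nat (S m))%Z with (s + Z.of_nat m + 1)%Z by lia.
  cbn [mon]; replace (s + Z.of_nat (S m))%Z with (s + Z.of_nat m + 1)%Z by lia.
  split.
  + rewrite Hs; replace (s + Z.of_nat m + 1 - 1)%Z with (s + Z.of_nat m)%Z by lia.
    rewrite IH1, IH2; unfold mmul, tmat; simpl; ring.
  + rewrite IH1; unfold mmul, tmat; simpl; ring.
Qed.

(** Cayley-Hamilton across a site: the two windows may differ at [t] itself. *)
Lemma trace_recurrence v psi t m : solves v psi ->
  (forall i, (1 <= i <= Z.of_nat m)%Z ->
     v (t - Z.of_nat (S m) + i)%Z = v (t + i)%Z) ->
  (psi (t + Z.of_nat (S m))%Z + psi (t - Z.of_nat (S m))%Z =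
   mtr (mon v (t - Z.of_nat (S m)) (S m)) * psi t)%C.
Proof.
intros Hs Hv.
cbn [mon]; replace (t - Z.of_nat (S m) + Z.of_nat (S m))%Z with t by lia.
rewrite mtr_tmat_mul.
destruct (mon_solves v psi t m Hs) as [E1 _].
destruct (mon_solves v psi (t - Z.of_nat (S m)) m Hs) as [E2 E3].
rewrite <- (mon_ext v _ _ m Hv) in E1.
pose proof (mdet_mon v (t - Z.of_nat (S m)) m) as HD.
set (P := mon v (t - Z.of_nat (S m)) m) in *; clearbody P.
replace (t - Z.of_nat (S m) + Z.of_nat m + 1)%Z with t in E2 by lia.
replace (t - Z.of_nat (S m) + Z.of_nat m)%Z with (t - 1)%Z in E3 by lia.
replace (t + Z.of_nat (S m))%Z with (t + Z.of_nat m + 1)%Z by lia.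
(* Since [P] has determinant 1, its adjugate inverts it and carries the solution back to the
   left. *)
assert (E4 : psi (t - Z.of_nat (S m))%Z = (m11 P * psi (t - 1)%Z - m21 P * psi t)%C).
{ transitivity (mdet P * psi (t - Z.of_nat (S m))%Z)%C; [rewrite HD; ring|].
  rewrite E2, E3; unfold mdet; ring. }
rewrite E1, E4, (Hs t); ring.
Qed.

(** Sliding the window by one site conjugates its matrix by a one-site matrix when the entering and
    leaving values agree. *)
Lemma mtr_mon_shift v s L : v (s + 1 + Z.of_nat L)%Z = v (s + 1)%Z ->
  mtr (mon v (s + 1) L) = mtr (mon v s L).
Proof.
intros Hv; symmetry; apply (mtr_tmat_conj (v (s + 1)%Z)).
transitivity (mon v s (S L)).
- cbn [mon]; rewrite <- Hv; do 3 f_equal; lia.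
- change (S L) with (1 + L)%nat; rewrite mon_add; cbn [mon].
  rewrite mmul_1_r; reflexivity.
Qed.

Lemma solves_zero v psi s : solves v psi ->
  psi s = 0%C -> psi (s + 1)%Z = 0%C -> forall n, psi n = 0%C.
Proof.
intros Hs H0 H1.
assert (F : forall m : nat, psi (s + Z.of_nat m)%Z = 0%C /\ psi (s + Z.of_nat m + 1)%Z = 0%C).
{ intros m; destruct (mon_solves v psi s m Hs) as [-> ->]; rewrite H0, H1; split; ring. }
assert (B : forall m : nat, psi (s - Z.of_nat m)%Z = 0%C /\ psi (s - Z.of_nat m + 1)%Z = 0%C).
{ induction m as [|m [B0 B1]]; [rewrite Z.sub_0_r; auto|].
  replace (s - Z.of_nat (S m) + 1)%Z with (s - Z.of_nat m)%Z by lia; split; [|exact B0].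
  replace (s - Z.of_nat (S m))%Z with (s - Z.of_nat m - 1)%Z by lia.
  pose proof (Hs (s - Z.of_nat m)%Z) as E; rewrite B0, B1 in E.
  transitivity (v (s - Z.of_nat m)%Z * 0 -
    (v (s - Z.of_nat m)%Z * 0 - psi (s - Z.of_nat m - 1)%Z))%C; [ring|].
  rewrite <- E; ring. }
intros n; destruct (Z_le_gt_dec s n).
- replace n with (s + Z.of_nat (Z.to_nat (n - s)))%Z by lia; apply F.
- replace n with (s - Z.of_nat (Z.to_nat (s - n)))%Z by lia; apply B.
Qed.

(** * Square summability and decay on the integers *)

Lemma nonneg_series_bounded (u : nat -> R) : (forall n, 0 <= u n) -> ex_series u ->
  exists B, forall n, sum_n u n <= B.
Proof.
intros Hu [l Hl]; exists l; intros n.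
apply (is_lim_seq_incr_compare (sum_n u)).
- exact Hl.
- intros k; rewrite sum_Sn; unfold plus; simpl; specialize (Hu (S k)); lra.
Qed.

(** [G] is a bounded primitive of the squared modulus, so that the mass of any interval on either
    side of 0 is a difference of two values of [G]. *)
Lemma l2Z_cumulative psi : l2Z psi ->
  exists (G : Z -> R) (B : R), (forall n, G n = G (n - 1)%Z + Cmod (psi n) ^ 2) /\
    forall n, - B <= G n <= B.
Proof.
intros [Hp Hm].
apply nonneg_series_bounded in Hp; [|intros; apply pow2_ge_0].
apply nonneg_series_bounded in Hm; [|intros; apply pow2_ge_0].
destruct Hp as [Bp Hp], Hm as [Bm Hm].
set (u := fun n : nat => Cmod (psi (Z.of_nat n)) ^ 2) in *.
set (w := fun n : nat => Cmod (psi (- Z.of_nat n)%Z) ^ 2) in *.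
assert (Pu : forall n, 0 <= sum_n u n).
{ induction n as [|n IH]; [rewrite sum_O; apply pow2_ge_0|].
  rewrite sum_Sn; unfold plus; simpl. pose proof (pow2_ge_0 (Cmod (psi (Z.of_nat (S n))))).
  unfold u at 2; simpl in *; lra. }
assert (Pw : forall n, 0 <= sum_n w n).
{ induction n as [|n IH]; [rewrite sum_O; apply pow2_ge_0|].
  rewrite sum_Sn; unfold plus; simpl. pose proof (pow2_ge_0 (Cmod (psi (- Z.of_nat (S n))%Z))).
  unfold w at 2; simpl in *; lra. }
(* Both one-sided series contain the site 0, hence its term is added back on the negative side. *)
exists (fun n => if Z_le_gt_dec 0 n then sum_n u (Z.to_nat n)
                 else Cmod (psi 0%Z) ^ 2 - sum_n w (Z.to_nat (- n - 1))).
exists (Bp + Bm + Cmod (psi 0%Z) ^ 2).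
pose proof (pow2_ge_0 (Cmod (psi 0%Z))) as P0.
split.
- intros n. destruct (Z_le_gt_dec 0 n), (Z_le_gt_dec 0 (n - 1)); try lia.
  + replace (Z.to_nat n) with (S (Z.to_nat (n - 1))) by lia.
    rewrite sum_Sn; unfold plus, u at 2; simpl AbelianMonoid.sort.
    replace (Z.of_nat (S (Z.to_nat (n - 1)))) with n by lia; reflexivity.
  + assert (n = 0%Z) as -> by lia; cbn [Z.to_nat Z.sub Z.add Z.opp Z.pos_sub Pos.sub Z.leb].
    replace (Z.to_nat (- (-1) - 1)) with O by lia.
    rewrite !sum_O; unfold u, w; simpl; lra.
  + replace (Z.to_nat (- (n - 1) - 1)) with (S (Z.to_nat (- n - 1))) by lia.
    rewrite sum_Sn; unfold plus, w at 3; simpl AbelianMonoid.sort.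
    replace (- Z.of_nat (S (Z.to_nat (- n - 1))))%Z with n by lia.
    simpl plus; simpl; lra.
- intros n.
  specialize (Hp (Z.to_nat n)) as Hp1; specialize (Pu (Z.to_nat n)) as Pu1.
  specialize (Hm (Z.to_nat (- n - 1))) as Hm1; specialize (Pw (Z.to_nat (- n - 1))) as Pw1.
  destruct (Z_le_gt_dec 0 n); lra.
Qed.

Lemma monotone_bounded_tail (F : Z -> R) (B : R) :
  (forall m k, (m <= k)%Z -> F m <= F k) -> (forall k, F k <= B) ->
  forall eps, 0 < eps ->
  exists N : Z, forall m k, (N <= m <= k)%Z -> F k - F m <= eps.
Proof.
intros Hm HB eps Heps.
destruct (completeness (fun r => exists k, r = F k)) as [M [HM1 HM2]].
- exists B; intros r [k ->]; apply HB.
- exists (F 0%Z), 0%Z; reflexivity.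
- destruct (classic (exists N, M - eps < F N)) as [[N HN]|HN].
  + exists N; intros m k Hk.
    assert (F k <= M) by (apply HM1; now exists k).
    pose proof (Hm N m ltac:(lia)); lra.
  + exfalso; assert (M <= M - eps); [|lra].
    apply HM2; intros r [k ->]; apply Rnot_lt_le; intros Hk; apply HN; now exists k.
Qed.

Lemma l2Z_tails psi : l2Z psi ->
  exists G : Z -> R, (forall m, G m = G (m - 1)%Z + Cmod (psi m) ^ 2) /\
    (forall m k, (m <= k)%Z -> G m <= G k) /\
    forall eps, 0 < eps -> exists N : Z, (0 <= N)%Z /\
      (forall m k, (N <= m <= k)%Z -> G k - G m <= eps) /\
      (forall m k, (m <= k <= - N)%Z -> G k - G m <= eps).
Proof.
intros H2; destruct (l2Z_cumulative psi H2) as [G [B [HG HB]]].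
assert (Hm : forall m k, (m <= k)%Z -> G m <= G k).
{ intros m k Hk; replace k with (m + Z.of_nat (Z.to_nat (k - m)))%Z by lia.
  induction (Z.to_nat (k - m)) as [|j IH]; [rewrite Z.add_0_r; lra|].
  rewrite (HG (m + Z.of_nat (S j))%Z).
  replace (m + Z.of_nat (S j) - 1)%Z with (m + Z.of_nat j)%Z by lia.
  pose proof (pow2_ge_0 (Cmod (psi (m + Z.of_nat (S j))%Z))); lra. }
exists G; split; [exact HG|split; [exact Hm|]].
intros eps Heps.
destruct (monotone_bounded_tail G B Hm) with (eps := eps) as [N1 HN1]; [apply HB|exact Heps|].
destruct (monotone_bounded_tail (fun k => - G (- k)%Z) B) with (eps := eps) as [N2 HN2].
- intros m k Hk; apply Ropp_le_contravar, Hm; lia.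
- intros k; pose proof (HB (- k)%Z); lra.
- exact Heps.
- exists (Z.max 0 (Z.max N1 N2)); split; [lia|split; intros m k Hk].
  + apply HN1; lia.
  + pose proof (HN2 (- k)%Z (- m)%Z ltac:(lia)) as H; rewrite !Z.opp_involutive in H; lra.
Qed.

Definition decays (psi : Z -> C) : Prop :=
  forall eps, 0 < eps -> exists N : Z, forall m, (N <= Z.abs m)%Z -> Cmod (psi m) <= eps.

Lemma l2Z_decays psi : l2Z psi -> decays psi.
Proof.
intros H2 eps Heps; destruct (l2Z_tails psi H2) as [G [HG [_ HT]]].
destruct (HT (eps ^ 2)) as [N [HN [Hp Hm]]]; [nra|].
exists (N + 1)%Z; intros m Hk; pose proof (HG m) as E; pose proof (Cmod_ge_0 (psi m)).
destruct (Z_le_gt_dec 0 m).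
- pose proof (Hp (m - 1)%Z m ltac:(lia)); nra.
- pose proof (Hm (m - 1)%Z m ltac:(lia)); nra.
Qed.

Lemma decays_growth_zero psi s d : decays psi -> d <> 0%Z ->
  (forall j : nat, Cmod (psi (s + Z.of_nat j * d)%Z) <= Cmod (psi (s + Z.of_nat (S j) * d)%Z)) ->
  psi s = 0%C.
Proof.
intros Hd Hd0 Hg; apply Cmod_eq_0; apply Rle_antisym; [|apply Cmod_ge_0].
assert (Hj : forall j : nat, Cmod (psi s) <= Cmod (psi (s + Z.of_nat j * d)%Z)).
{ induction j as [|j IH]; [simpl; rewrite Z.add_0_r; lra|].
  eapply Rle_trans; [exact IH|apply Hg]. }
apply le_epsilon; intros eps Heps; rewrite Rplus_0_l.
destruct (Hd eps Heps) as [N HN].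
eapply Rle_trans; [apply (Hj (Z.to_nat (Z.abs N + Z.abs s)))|apply HN].
rewrite Z2Nat.id by lia; nia.
Qed.

(** The moduli do not decrease to the right if [rho] is at least 1, and do not decrease to the left
    otherwise. *)
Lemma decays_geometric_zero psi s d rho : decays psi -> d <> 0%Z ->
  (forall j : Z, Cmod (psi (s + (j + 1) * d)%Z) = rho * Cmod (psi (s + j * d)%Z)) ->
  psi s = 0%C.
Proof.
intros Hd Hd0 Hg; destruct (Rle_dec 1 rho) as [H1|H1].
- apply (decays_growth_zero psi s d); [exact Hd|exact Hd0|]; intros j.
  pose proof (Cmod_ge_0 (psi (s + Z.of_nat j * d)%Z)).
  pose proof (Hg (Z.of_nat j)) as E.
  replace (Z.of_nat j + 1)%Z with (Z.of_nat (S j)) in E by lia; nra.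
- apply (decays_growth_zero psi s (- d)); [exact Hd|lia|]; intros j.
  pose proof (Cmod_ge_0 (psi (s + Z.of_nat (S j) * - d)%Z)) as P.
  pose proof (Hg (- Z.of_nat (S j))%Z) as E.
  replace (s + (- Z.of_nat (S j) + 1) * d)%Z with (s + Z.of_nat j * - d)%Z in E by lia.
  replace (s + - Z.of_nat (S j) * d)%Z with (s + Z.of_nat (S j) * - d)%Z in E by lia.
  nra.
Qed.

(** One neighbour of [s] is at least as large as [s]; with the factor 3, a step without decrease
    forces another one in the same direction. *)
Lemma decays_convex_zero psi s d : decays psi -> d <> 0%Z ->
  (forall j : Z, 3 * Cmod (psi (s + j * d)%Z) <=
     Cmod (psi (s + (j + 1) * d)%Z) + Cmod (psi (s + (j - 1) * d)%Z)) ->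
  psi s = 0%C.
Proof.
intros Hd Hd0 Hg.
assert (Hdir : forall d', (d' = d \/ d' = - d)%Z ->
  Cmod (psi s) <= Cmod (psi (s + d')%Z) -> psi s = 0%C).
{ intros d' Hd' H0; apply (decays_growth_zero psi s d'); [exact Hd|lia|].
  induction j as [|j IH].
  - simpl Z.of_nat; rewrite Z.mul_0_l, Z.mul_1_l, Z.add_0_r; exact H0.
  - pose proof (Cmod_ge_0 (psi (s + Z.of_nat (S j) * d')%Z)).
    destruct Hd' as [->| ->].
    + pose proof (Hg (Z.of_nat (S j))) as E.
      replace (Z.of_nat (S j) + 1)%Z with (Z.of_nat (S (S j))) in E by lia.
      replace (Z.of_nat (S j) - 1)%Z with (Z.of_nat j) in E by lia; lra.
    + pose proof (Hg (- Z.of_nat (S j))%Z) as E.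
      replace (s + (- Z.of_nat (S j) + 1) * d)%Z with (s + Z.of_nat j * - d)%Z in E by lia.
      replace (s + - Z.of_nat (S j) * d)%Z with (s + Z.of_nat (S j) * - d)%Z in E by lia.
      replace (s + (- Z.of_nat (S j) - 1) * d)%Z
        with (s + Z.of_nat (S (S j)) * - d)%Z in E by lia.
      lra. }
pose proof (Hg 0%Z) as E; pose proof (Cmod_ge_0 (psi s)).
replace (s + 0 * d)%Z with s in E by lia.
replace (s + (0 + 1) * d)%Z with (s + d)%Z in E by lia.
replace (s + (0 - 1) * d)%Z with (s + - d)%Z in E by lia.
destruct (Rle_dec (Cmod (psi s)) (Cmod (psi (s + d)%Z))) as [H1|H1].
- apply (Hdir d); auto.
- apply (Hdir (- d)%Z); [auto|lra].
Qed.

(** * Estimates of Gordon type *)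

Lemma gordon_two (x u0 u1 u2 : C) (B : R) : (u2 + u0 = x * u1)%C -> Cmod x <= B ->
  Cmod u0 <= B * Cmod u1 + Cmod u2.
Proof.
intros E HB; replace u0 with (x * u1 - u2)%C by (rewrite <- E; ring).
pose proof (Cmod_triangle (x * u1) (- u2)) as H.
rewrite Cmod_opp, Cmod_mult in H; unfold Cminus; pose proof (Cmod_ge_0 u1); nra.
Qed.

Lemma gordon_lower (x u1 u0 w : C) : (u1 + w = x * u0)%C ->
  Cmod x * Cmod u0 <= Cmod u1 + Cmod w.
Proof. intros E; rewrite <- Cmod_mult, <- E; apply Cmod_triangle. Qed.

(** No bound on [x] is required: a small [x] makes the second relation useful, a large one the
    first. *)
Lemma gordon_three (x w u0 u1 u2 : C) : (u1 + w = x * u0)%C -> (u2 + u0 = x * u1)%C ->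
  Cmod u0 <= Cmod w + Cmod u1 + Cmod u2.
Proof.
intros E1 E2; pose proof (Cmod_ge_0 w); pose proof (Cmod_ge_0 u1).
pose proof (Cmod_ge_0 u2); pose proof (Cmod_ge_0 u0).
destruct (Rle_dec (Cmod x) 1) as [Hx|Hx].
- pose proof (gordon_two x u0 u1 u2 1 E2 Hx); lra.
- pose proof (gordon_lower x u1 u0 w E1); nra.
Qed.

(** * The hierarchy of holes and its block traces *)

(** Levels at which the coding sequence repeats its letter are merged, so that the letters
    [beta i] alternate. *)
Record levels (v : Z -> C) (L : nat -> nat) (h : nat -> Z) (n : nat -> nat)
    (beta : nat -> bool) (c : Z -> bool) (val : bool -> C) : Prop := {
  lv_pos : (1 <= L O)%nat;
  lv_n : forall i, (2 <= n i)%nat;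
  lv_S : forall i, L (S i) = (n i * L i)%nat;
  lv_h : forall i, (Z.of_nat (L i) | h (S i) - h i)%Z;
  lv_beta : forall i, beta (S i) = negb (beta i);
  lv_per : forall t, ~ (Z.of_nat (L O) | t - h O)%Z -> v (t + Z.of_nat (L O))%Z = v t;
  lv_val : forall t, (Z.of_nat (L O) | t - h O)%Z -> v t = val (c t);
  lv_fill : forall i t, (Z.of_nat (L i) | t - h i)%Z ->
    ~ (Z.of_nat (L (S i)) | t - h (S i))%Z -> c t = beta i
}.

Arguments lv_n {v L h n beta c val}.
Arguments lv_S {v L h n beta c val}.
Arguments lv_h {v L h n beta c val}.
Arguments lv_beta {v L h n beta c val}.
Arguments lv_val {v L h n beta c val}.

Section Levels.
Context (v : Z -> C) (L : nat -> nat) (h : nat -> Z) (n : nat -> nat)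
  (beta : nat -> bool) (c : Z -> bool) (val : bool -> C).
Context (HL : levels v L h n beta c val).

Definition hole (i : nat) (t : Z) : Prop := (Z.of_nat (L i) | t - h i)%Z.

Lemma level_pos i : (1 <= L i)%nat.
Proof.
induction i as [|i IH]; [apply HL|].
rewrite (lv_S HL); pose proof (lv_n HL i); nia.
Qed.

Lemma level_double i : (2 * L i <= L (S i))%nat.
Proof.
rewrite (lv_S HL); pose proof (lv_n HL i); nia.
Qed.

Lemma level_gt_index i : (i < L i)%nat.
Proof.
induction i as [|i IH]; [apply HL|]; pose proof (level_double i); lia.
Qed.

Lemma level_mono i j : (i <= j)%nat -> (L i <= L j)%nat.
Proof. induction 1; [lia|]; pose proof (level_double m); lia. Qed.

Lemma hole_add i t k : hole i (t + k * Z.of_nat (L i)) <-> hole i t.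
Proof.
unfold hole; split; intros [q Hq].
- exists (q - k)%Z; lia.
- exists (q + k)%Z; lia.
Qed.

Lemma hole_S i t : hole (S i) t -> hole i t.
Proof.
intros [q Hq]; destruct (lv_h HL i) as [q' Hq'].
exists (q * Z.of_nat (n i) + q')%Z.
rewrite (lv_S HL), Nat2Z.inj_mul in Hq; lia.
Qed.

Lemma hole_0 i t : hole i t -> hole 0 t.
Proof. induction i; [auto|]; intros H; apply IHi, hole_S, H. Qed.

Lemma hole_val i t : hole i t -> v t = val (c t).
Proof. intros H; apply HL; apply (hole_0 i t H). Qed.

Lemma hole_fill i t : hole i t -> ~ hole (S i) t -> c t = beta i.
Proof. apply HL. Qed.

Lemma hole_h i k : hole i (h i + k * Z.of_nat (L i)).
Proof. exists k; lia. Qed.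

Lemma hole_base i : hole i (h i).
Proof. rewrite <- (Z.add_0_r (h i)), <- (Z.mul_0_l (Z.of_nat (L i))); apply hole_h. Qed.

Lemma not_hole_between i H t : hole i H ->
  (H < t < H + Z.of_nat (L i))%Z -> ~ hole i t.
Proof. intros [q Hq] Ht [q' Hq']. assert (0 < q' - q < 1)%Z by nia; lia. Qed.

Lemma per_mul_of_per i :
  (forall t, ~ hole i t -> v (t + Z.of_nat (L i))%Z = v t) ->
  forall k t, ~ hole i t -> v (t + k * Z.of_nat (L i))%Z = v t.
Proof.
intros Hp.
assert (Hn : forall m t, ~ hole i t -> v (t + Z.of_nat m * Z.of_nat (L i))%Z = v t).
{ induction m as [|m IH]; intros t Ht; [f_equal; lia|].
  rewrite <- (IH t Ht), <- (Hp (t + Z.of_nat m * Z.of_nat (L i))%Z); [f_equal; lia|].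
  now rewrite hole_add. }
intros k t Ht; destruct (Z_le_gt_dec 0 k).
- rewrite <- (Hn (Z.to_nat k) t Ht); f_equal; lia.
- rewrite <- (Hn (Z.to_nat (- k)) (t + k * Z.of_nat (L i))%Z); [f_equal; lia|].
  now rewrite hole_add.
Qed.

(** A site that stops being a hole at level [S i] carries [beta i], and so does its translate; every
    other non-hole is already periodic at level [i]. *)
Lemma per_level i t : ~ hole i t -> v (t + Z.of_nat (L i))%Z = v t.
Proof.
revert t; induction i as [|i IH]; intros t Ht; [now apply HL|].
replace (t + Z.of_nat (L (S i)))%Z with (t + Z.of_nat (n i) * Z.of_nat (L i))%Z
  by (rewrite (lv_S HL); lia).
destruct (classic (hole i t)) as [Hi|Hi]; [|now apply per_mul_of_per].
assert (Hi' : hole i (t + Z.of_nat (n i) * Z.of_nat (L i))) by now rewrite hole_add.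
rewrite (hole_val i _ Hi), (hole_val i _ Hi').
rewrite (hole_fill i _ Hi Ht), (hole_fill i _ Hi'); [reflexivity|].
replace (t + Z.of_nat (n i) * Z.of_nat (L i))%Z with (t + 1 * Z.of_nat (L (S i)))%Z
  by (rewrite (lv_S HL); lia).
now rewrite hole_add.
Qed.

Lemma per_mul i k t : ~ hole i t -> v (t + k * Z.of_nat (L i))%Z = v t.
Proof. apply per_mul_of_per, per_level. Qed.

(** The hole itself is left out, so one matrix serves both letters; [ltr i e] closes it up with a
    hole of letter [e]. *)
Definition block (i : nat) : mat2 := mon v (h i) (L i - 1).
Definition ltr (i : nat) (e : bool) : C := mtr (mmul (tmat (val e)) (block i)).

Lemma mon_block i H : hole i H -> mon v H (L i - 1) = block i.
Proof.
intros HH; apply mon_ext; intros j Hj.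
assert (HN : ~ hole i (h i + j)).
{ apply (not_hole_between i (h i)); [apply hole_base|lia]. }
destruct HH as [q Hq].
rewrite <- (per_mul i q _ HN); f_equal; lia.
Qed.

Lemma mon_full_block i H : hole i H ->
  mon v (H - Z.of_nat (L i)) (L i) = mmul (tmat (val (c H))) (block i).
Proof.
intros HH; pose proof (level_pos i).
replace (L i) with (S (L i - 1)) at 2 by lia; cbn [mon]; f_equal.
- rewrite <- (hole_val i H HH); do 2 f_equal; lia.
- apply mon_block.
  replace (H - Z.of_nat (L i))%Z with (H + (-1) * Z.of_nat (L i))%Z by lia.
  now apply hole_add.
Qed.

(** The window ends at [t] and contains the single hole [H]. Slide it from [t = H] to the right:
    entering and leaving sites are never holes and agree by periodicity. *)
Lemma mtr_window i H t : hole i H -> (H <= t < H + Z.of_nat (L i))%Z ->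
  mtr (mon v (t - Z.of_nat (L i)) (L i)) = ltr i (c H).
Proof.
intros HH Ht.
replace t with (H + Z.of_nat (Z.to_nat (t - H)))%Z in * by lia.
revert Ht; generalize (Z.to_nat (t - H)) as m; clear t; intros m.
induction m as [|m IH]; intros Ht.
- rewrite Z.add_0_r; unfold ltr; now rewrite mon_full_block.
- rewrite <- IH by lia.
  replace (H + Z.of_nat (S m) - Z.of_nat (L i))%Z
    with (H + Z.of_nat m - Z.of_nat (L i) + 1)%Z by lia.
  apply mtr_mon_shift.
  rewrite <- (per_mul i (-1) (H + Z.of_nat m - Z.of_nat (L i) + 1 + Z.of_nat (L i))%Z).
  + f_equal; lia.
  + apply (not_hole_between i H); [exact HH|lia].
Qed.

Section Solution.
Context (psi : Z -> C) (Hs : solves v psi).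

(** The windows on both sides of [t] contain no hole, so they agree whatever letters the
    neighbouring holes carry. *)
Lemma rec_hole i t : hole i t ->
  (psi (t + Z.of_nat (L i))%Z + psi (t - Z.of_nat (L i))%Z = ltr i (c t) * psi t)%C.
Proof.
intros Ht; pose proof (level_pos i).
rewrite <- (mtr_window i t t Ht) by lia.
replace (L i) with (S (L i - 1)) by lia; apply trace_recurrence; [exact Hs|].
intros j Hj; replace (S (L i - 1)) with (L i) by lia.
rewrite <- (per_mul i (-1) (t + j)%Z); [f_equal; lia|].
apply (not_hole_between i t); [exact Ht|lia].
Qed.

Lemma rec_between i H e t : hole i H -> (H < t <= H + Z.of_nat (L i))%Z ->
  c H = e -> c (H + Z.of_nat (L i))%Z = e ->
  (psi (t + Z.of_nat (L i))%Z + psi (t - Z.of_nat (L i))%Z = ltr i e * psi t)%C.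
Proof.
intros HH Ht E1 E2; pose proof (level_pos i).
assert (HH' : hole i (H + Z.of_nat (L i))).
{ rewrite <- (Z.mul_1_l (Z.of_nat (L i))); now apply hole_add. }
destruct (Z.eq_dec t (H + Z.of_nat (L i))) as [->|Hne].
{ now rewrite (rec_hole i _ HH'), E2. }
subst e; rewrite <- (mtr_window i H t HH) by lia.
replace (L i) with (S (L i - 1)) by lia; apply trace_recurrence; [exact Hs|].
intros j Hj; replace (S (L i - 1)) with (L i) by lia.
destruct (Z.eq_dec (t - Z.of_nat (L i) + j) H) as [E|E].
- replace (t + j)%Z with (H + Z.of_nat (L i))%Z by lia.
  now rewrite E, (hole_val i _ HH), (hole_val i _ HH'), E2.
- rewrite <- (per_mul i 1 (t - Z.of_nat (L i) + j)%Z); [f_equal; lia|].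
  destruct (Z_lt_le_dec (t - Z.of_nat (L i) + j) H) as [Hlt|Hge].
  + apply (not_hole_between i (H - Z.of_nat (L i))); [|lia].
    replace (H - Z.of_nat (L i))%Z with (H + (-1) * Z.of_nat (L i))%Z by lia.
    now apply hole_add.
  + apply (not_hole_between i H); [exact HH|lia].
Qed.

End Solution.

(** * Passing from the traces of one level to the next *)

Lemma ltr_diff i : (ltr i true - ltr i false = (val true - val false) * m11 (block i))%C.
Proof. unfold ltr; rewrite !mtr_tmat_mul; ring. Qed.

Fixpoint mpow (X : mat2) (j : nat) : mat2 :=
  match j with O => mone | S j' => mmul X (mpow X j') end.

(** Inside a block of level [S i] the blocks of level [i] are separated by holes of level [i] that
    all carry [beta i]. *)
Lemma block_pow i j : (j < n i)%nat ->
  mon v (h (S i)) (j * L i + (L i - 1)) =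
  mmul (block i) (mpow (mmul (tmat (val (beta i))) (block i)) j).
Proof.
pose proof (level_pos i) as HLi.
assert (H1 : hole i (h (S i))) by apply hole_S, hole_base.
induction j as [|j IH]; intros Hj.
- cbn [mpow]; rewrite mmul_1_r; now apply mon_block.
- assert (Hh : hole i (h (S i) + Z.of_nat (S j) * Z.of_nat (L i))) by now apply hole_add.
  assert (Hn : ~ hole (S i) (h (S i) + Z.of_nat (S j) * Z.of_nat (L i))).
  { apply (not_hole_between (S i) (h (S i))); [apply hole_base|].
    rewrite (lv_S HL); nia. }
  rewrite (mon_add v _ (S j * L i)).
  replace (S j * L i)%nat with (S (j * L i + (L i - 1))) at 2 by nia; cbn [mon].
  rewrite IH by lia.
  replace (h (S i) + Z.of_nat (S (j * L i + (L i - 1))))%Z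
    with (h (S i) + Z.of_nat (S j) * Z.of_nat (L i))%Z by nia.
  replace (h (S i) + Z.of_nat (S j * L i))%Z
    with (h (S i) + Z.of_nat (S j) * Z.of_nat (L i))%Z by nia.
  rewrite (mon_block i _ Hh), (hole_val i _ Hh), (hole_fill i _ Hh Hn).
  cbn [mpow]; f_equal; now rewrite mmul_assoc.
Qed.

(** [g j] is the trace of the cyclic word made of one block with letter [e] and
    [j] blocks with letter [beta i]. *)
Lemma ltr_S i e : exists g : nat -> C,
  g O = ltr i e /\ g 1%nat = (ltr i (beta i) * ltr i e - 2)%C /\
  (forall j, g (S (S j)) = (ltr i (beta i) * g (S j) - g j)%C) /\
  ltr (S i) e = g (n i - 1)%nat.
Proof.
set (A := mmul (tmat (val (beta i))) (block i)).
exists (fun j => mtr (mmul (mmul (tmat (val e)) (block i)) (mpow A j))).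
pose proof (level_pos i); pose proof (lv_n HL i).
assert (HA : mdet A = 1%C).
{ unfold A; rewrite mdet_mul, mdet_tmat; unfold block; rewrite mdet_mon; ring. }
repeat split.
- cbn [mpow]; now rewrite mmul_1_r.
- cbn [mpow]; rewrite mmul_1_r; apply mtr_tmat_mul2, mdet_mon.
- intros j; cbn [mpow]; now apply mtr_cayley.
- unfold ltr at 1, block at 1.
  replace (L (S i) - 1)%nat with ((n i - 1) * L i + (L i - 1))%nat
    by (rewrite (lv_S HL); nia).
  rewrite block_pow by lia; now rewrite mmul_assoc.
Qed.

Lemma ltr_S_three i e : n i = 3%nat ->
  ltr (S i) e = ((ltr i (beta i) * ltr i (beta i) - 1) * ltr i e - 2 * ltr i (beta i))%C.
Proof.
intros Hn; destruct (ltr_S i e) as [g [g0 [g1 [gS ->]]]].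
rewrite Hn; cbn [Nat.sub]; rewrite gS, g1, g0; ring.
Qed.

Lemma Cmod_sub_ge x y : Cmod x - Cmod y <= Cmod (x - y)%C.
Proof.
pose proof (Cmod_triangle (x - y)%C y) as H.
replace (x - y + y)%C with x in H by ring; lra.
Qed.

(** For [e = beta i] the sequence of [ltr_S] starts at [x] and x^2 - 2, and its recursion with |x|
    at least 3 keeps the moduli from decreasing. *)
Lemma ltr_S_large i : 3 <= Cmod (ltr i (beta i)) -> 3 <= Cmod (ltr (S i) (beta i)).
Proof.
intros Hx; destruct (ltr_S i (beta i)) as [g [g0 [g1 [gS ->]]]].
set (x := ltr i (beta i)) in *; clearbody x.
assert (Hg : forall j, 3 <= Cmod (g j) /\ Cmod (g j) <= Cmod (g (S j))).
{ induction j as [|j [IH1 IH2]].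
  - rewrite g0, g1; split; [exact Hx|].
    pose proof (Cmod_sub_ge (x * x)%C 2%C) as H; rewrite Cmod_mult, Cmod_R in H.
    rewrite Rabs_right in H by lra; nra.
  - split; [lra|].
    rewrite (gS j); pose proof (Cmod_sub_ge (x * g (S j))%C (g j)) as H.
    rewrite Cmod_mult in H; nra. }
apply Hg.
Qed.

(** * Constraints from a nonzero square summable solution *)

Section NoDecayingSolution.
Context (psi : Z -> C) (Hs : solves v psi) (H2 : l2Z psi).
Context (t0 : Z) (Ht0 : psi t0 <> 0%C).

Lemma decaying_solution : decays psi.
Proof. apply l2Z_decays, H2. Qed.

Lemma solves_block i H : hole i H ->
  psi (H + Z.of_nat (L i))%Z =
    (m11 (block i) * psi (H + 1)%Z + m12 (block i) * psi H)%C /\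
  psi (H + Z.of_nat (L i) - 1)%Z =
    (m21 (block i) * psi (H + 1)%Z + m22 (block i) * psi H)%C.
Proof.
intros HH; pose proof (level_pos i) as Hpos.
destruct (mon_solves v psi H (L i - 1) Hs) as [E1 E2].
rewrite (mon_block i H HH) in E1, E2; rewrite <- E1, <- E2; split; f_equal; lia.
Qed.

(** If this entry vanished, [psi] would be geometric along the holes and hence 0 there; then the
    values just after the holes would be geometric too, with ratio [- m21]. *)
Lemma block_m11_neq_0 i : m11 (block i) <> 0%C.
Proof.
intros H0; pose proof (level_pos i) as Hpos; pose proof decaying_solution as Hd.
assert (Hz : forall H, hole i H -> psi H = 0%C).
{ intros H HH; apply (decays_geometric_zero psi H (Z.of_nat (L i)) (Cmod (m12 (block i))));
    [exact Hd|lia|]; intros j.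
  rewrite <- Cmod_mult; f_equal.
  destruct (solves_block i (H + j * Z.of_nat (L i))%Z) as [E _]; [now apply hole_add|].
  rewrite H0 in E.
  replace (H + (j + 1) * Z.of_nat (L i))%Z
    with (H + j * Z.of_nat (L i) + Z.of_nat (L i))%Z by lia.
  rewrite E; ring. }
apply Ht0; apply (solves_zero v psi (h i) Hs); [apply Hz, hole_base|].
apply (decays_geometric_zero psi _ (Z.of_nat (L i)) (Cmod (- m21 (block i))));
  [exact Hd|lia|]; intros j.
rewrite <- Cmod_mult; f_equal.
destruct (solves_block i (h i + j * Z.of_nat (L i))%Z) as [_ E]; [apply hole_h|].
rewrite (Hz (h i + j * Z.of_nat (L i))%Z) in E by apply hole_h.
replace (h i + 1 + j * Z.of_nat (L i))%Z with (h i + j * Z.of_nat (L i) + 1)%Z by lia.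
replace (h i + 1 + (j + 1) * Z.of_nat (L i))%Z
  with (h i + j * Z.of_nat (L i) + Z.of_nat (L i) + 1)%Z by lia.
rewrite Hs, E, Hz; [ring|].
rewrite <- (Z.mul_1_l (Z.of_nat (L i))) at 2; apply hole_add, hole_h.
Qed.

Lemma not_both_traces_large i : ~ (forall e, 3 <= Cmod (ltr i e)).
Proof.
intros Hlarge; pose proof (level_pos i) as Hpos; pose proof decaying_solution as Hd.
assert (Hz : forall H, hole i H -> psi H = 0%C).
{ intros H HH; apply (decays_convex_zero psi H (Z.of_nat (L i))); [exact Hd|lia|].
  intros j.
  assert (Hj : hole i (H + j * Z.of_nat (L i))) by now apply hole_add.
  pose proof (gordon_lower _ _ _ _ (rec_hole psi Hs i _ Hj)) as E.
  pose proof (Hlarge (c (H + j * Z.of_nat (L i))%Z)).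
  pose proof (Cmod_ge_0 (psi (H + j * Z.of_nat (L i))%Z)).
  replace (H + (j + 1) * Z.of_nat (L i))%Z
    with (H + j * Z.of_nat (L i) + Z.of_nat (L i))%Z by lia.
  replace (H + (j - 1) * Z.of_nat (L i))%Z
    with (H + j * Z.of_nat (L i) - Z.of_nat (L i))%Z by lia.
  nra. }
apply Ht0; apply (solves_zero v psi (h i) Hs); [apply Hz, hole_base|].
(* Zeros at two consecutive holes give [m11 (block i) * psi (h i + 1) = 0], and [m11] is nonzero. *)
destruct (solves_block i (h i) (hole_base i)) as [E _].
rewrite (Hz (h i)) in E by apply hole_base.
rewrite Hz in E
  by (rewrite <- (Z.mul_1_l (Z.of_nat (L i))); apply hole_add, hole_base).
destruct (classic (psi (h i + 1)%Z = 0%C)) as [Hx|Hx]; [exact Hx|exfalso].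
apply (Cmult_neq_0 _ _ (block_m11_neq_0 i) Hx).
transitivity (m11 (block i) * psi (h i + 1)%Z + m12 (block i) * 0)%C; [ring|].
now rewrite <- E.
Qed.

(** * Position of [t0] among the holes *)

Definition next_hole (i : nat) : Z := (t0 + (h i - t0) mod Z.of_nat (L i))%Z.

(** [letter i (-1)] and [letter i 0] belong to the holes on either side of [t0]; if [t0]
    is itself a hole then [letter i 0] is its letter. *)
Definition letter (i : nat) (j : Z) : bool := c (next_hole i + j * Z.of_nat (L i))%Z.

Lemma next_hole_range i : (t0 <= next_hole i < t0 + Z.of_nat (L i))%Z.
Proof.
unfold next_hole; pose proof (level_pos i) as Hpos.
pose proof (Z.mod_pos_bound (h i - t0) (Z.of_nat (L i)) ltac:(lia)); lia.
Qed.

Lemma next_hole_hole i : hole i (next_hole i).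
Proof.
unfold next_hole, hole; pose proof (level_pos i) as Hpos.
exists (- ((h i - t0) / Z.of_nat (L i)))%Z.
pose proof (Z.div_mod (h i - t0) (Z.of_nat (L i)) ltac:(lia)); lia.
Qed.

Lemma letter_rec i e j : letter i (j - 1) = e -> letter i j = e ->
  (psi (t0 + (j + 1) * Z.of_nat (L i))%Z + psi (t0 + (j - 1) * Z.of_nat (L i))%Z =
   ltr i e * psi (t0 + j * Z.of_nat (L i))%Z)%C.
Proof.
intros E1 E2; pose proof (next_hole_range i).
rewrite <- (rec_between psi Hs i (next_hole i + (j - 1) * Z.of_nat (L i))%Z e).
- f_equal; f_equal; lia.
- apply hole_add, next_hole_hole.
- lia.
- exact E1.
- rewrite <- E2; unfold letter; f_equal; lia.
Qed.

(** One tenth suffices for both Gordon bounds: three far values give 3/10, and a trace below 3 gives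
    3/10 + 1/10, each less than 1. *)
Lemma far_small : exists I, forall i, (I <= i)%nat -> forall k, (1 <= Z.abs k <= 2)%Z ->
  Cmod (psi (t0 + k * Z.of_nat (L i))%Z) <= Cmod (psi t0) / 10.
Proof.
pose proof (proj1 (Cmod_gt_0 _) Ht0) as P.
destruct (decaying_solution (Cmod (psi t0) / 10)) as [N HN]; [lra|].
exists (Z.to_nat (N + Z.abs t0)); intros i Hi k Hk; apply HN.
pose proof (level_gt_index i); nia.
Qed.

(** Three equal letters around [t0] allow [gordon_three]. Two equal letters on one side of it allow
    only [gordon_two], which fails just when the trace is large. *)
Lemma gordon_letters : exists I, forall i, (I <= i)%nat ->
  ~ (letter i 0 = letter i (-1) /\ letter i 1 = letter i 0) /\
  ~ (letter i (-1) = letter i (-2) /\ letter i 0 = letter i (-1)) /\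
  (letter i 1 = letter i 0 -> 3 <= Cmod (ltr i (letter i 0))) /\
  (letter i (-1) = letter i (-2) -> 3 <= Cmod (ltr i (letter i (-1)))).
Proof.
pose proof (proj1 (Cmod_gt_0 _) Ht0) as P.
destruct far_small as [I HI]; exists I; intros i Hi.
pose proof (HI i Hi 1%Z ltac:(lia)) as S1; pose proof (HI i Hi 2%Z ltac:(lia)) as S2.
pose proof (HI i Hi (-1)%Z ltac:(lia)) as S3; pose proof (HI i Hi (-2)%Z ltac:(lia)) as S4.
assert (R0 : forall e, letter i (-1) = e -> letter i 0 = e ->
  (psi (t0 + 1 * Z.of_nat (L i))%Z + psi (t0 + -1 * Z.of_nat (L i))%Z = ltr i e * psi t0)%C).
{ intros e E1 E2; pose proof (letter_rec i e 0 E1 E2) as E; simpl in E.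
  rewrite Z.add_0_r in E; exact E. }
assert (R1 : forall e, letter i 0 = e -> letter i 1 = e ->
  (psi (t0 + 2 * Z.of_nat (L i))%Z + psi t0 = ltr i e * psi (t0 + 1 * Z.of_nat (L i))%Z)%C).
{ intros e E1 E2; pose proof (letter_rec i e 1 E1 E2) as E.
  change (1 + 1)%Z with 2%Z in E; change (1 - 1)%Z with 0%Z in E.
  rewrite Z.mul_0_l, Z.add_0_r in E; exact E. }
assert (R2 : forall e, letter i (-2) = e -> letter i (-1) = e ->
  (psi (t0 + -2 * Z.of_nat (L i))%Z + psi t0 = ltr i e * psi (t0 + -1 * Z.of_nat (L i))%Z)%C).
{ intros e E1 E2; pose proof (letter_rec i e (-1) E1 E2) as E.
  change (-1 + 1)%Z with 0%Z in E; change (-1 - 1)%Z with (-2)%Z in E.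
  rewrite Z.mul_0_l, Z.add_0_r, Cplus_comm in E; exact E. }
repeat split.
- intros [E1 E2]; pose proof (gordon_three _ _ _ _ _ (R0 _ eq_refl E1)
    (R1 _ E1 (eq_trans E2 E1))); lra.
- intros [E1 E2].
  pose proof (R0 _ eq_refl E2) as F0; rewrite Cplus_comm in F0.
  pose proof (gordon_three _ _ _ _ _ F0 (R2 _ (eq_sym E1) eq_refl)); lra.
- intros E; apply Rnot_lt_le; intros Hlt.
  pose proof (gordon_two _ _ _ _ 3 (R1 _ eq_refl E) (Rlt_le _ _ Hlt)); lra.
- intros E; apply Rnot_lt_le; intros Hlt.
  pose proof (gordon_two _ _ _ _ 3 (R2 _ (eq_sym E) eq_refl) (Rlt_le _ _ Hlt)); lra.
Qed.

Lemma next_hole_S i : exists r, (0 <= r < Z.of_nat (n i))%Z /\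
  next_hole (S i) = (next_hole i + r * Z.of_nat (L i))%Z.
Proof.
pose proof (level_pos i) as Hpos; pose proof (next_hole_range i).
pose proof (next_hole_range (S i)) as HR; rewrite (lv_S HL) in HR.
destruct (next_hole_hole i) as [q Hq].
destruct (hole_S i _ (next_hole_hole (S i))) as [q' Hq'].
exists (q' - q)%Z; split; [|lia].
assert (- 1 < q' - q < Z.of_nat (n i))%Z by nia; lia.
Qed.

(** Here [r] counts the steps of length [L i] from [next_hole i] to [next_hole (S i)], so it locates
    the block of [t0] inside its larger block. *)
Lemma letter_S i : exists r, (0 <= r < Z.of_nat (n i))%Z /\
  (forall j, ~ (Z.of_nat (n i) | j - r)%Z -> letter i j = beta i) /\
  (forall m, letter i (r + m * Z.of_nat (n i)) = letter (S i) m).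
Proof.
destruct (next_hole_S i) as [r [Hr E]]; exists r; split; [exact Hr|split].
- intros j Hj; apply hole_fill; [apply hole_add, next_hole_hole|].
  intros [q Hq]; apply Hj; destruct (next_hole_hole (S i)) as [q' Hq'].
  pose proof (level_pos i) as Hpos.
  exists (q - q')%Z; rewrite (lv_S HL) in *.
  apply (Z.mul_reg_r _ _ (Z.of_nat (L i))); [lia|]; rewrite E in Hq'; lia.
- intros m; unfold letter; rewrite E, (lv_S HL); f_equal; lia.
Qed.

(** In this configuration the recurrence holds at [t0] itself, which bounds the trace for [beta i]
    by two far values of [psi]. *)
Definition double (i : nat) : Prop := letter i (-1) = beta i /\ letter i 0 = beta i.

Lemma not_dvd_small (m k : Z) : (0 < Z.abs k < m)%Z -> ~ (m | k)%Z.
Proof.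
intros Hk Hd; apply Z.divide_abs_r, Z.divide_pos_le in Hd; lia.
Qed.

(** The block of level [i] containing [t0] is, respectively, the last, the last but one, or
    the first of the [n i] blocks that make up its block of level [i+1]. *)
Lemma letter_cases i :
  ~ (letter i 0 = letter i (-1) /\ letter i 1 = letter i 0) ->
  ~ (letter i (-1) = letter i (-2) /\ letter i 0 = letter i (-1)) ->
  (letter i 0 = beta (S i) /\ letter (S i) 0 = beta (S i) /\ letter i (-1) = beta i /\
     (letter i (-2) = beta i \/ letter i (-2) = letter (S i) (-1))) \/
  (double (S i) /\ (n i = 3%nat \/ letter i (-1) <> beta i)) \/
  (letter i 0 = beta i /\ letter i 1 = beta i /\
     letter i (-1) = beta (S i) /\ letter (S i) (-1) = beta (S i)).
Proof.
intros N1 N2; unfold double; rewrite !(lv_beta HL).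
pose proof (lv_n HL i) as Hn.
destruct (letter_S i) as [r [Hr [Hf Hm]]].
assert (Hfill : forall j, (0 < Z.abs (j - r) < Z.of_nat (n i))%Z -> letter i j = beta i)
  by (intros j Hj; apply Hf, not_dvd_small, Hj).
pose proof (Hm 0%Z) as M0; replace (r + 0 * Z.of_nat (n i))%Z with r in M0 by lia.
pose proof (Hm (-1)%Z) as M1.
replace (r + -1 * Z.of_nat (n i))%Z with (r - Z.of_nat (n i))%Z in M1 by lia.
destruct (Z.eq_dec r 0) as [->|Hr0].
{ left; pose proof (Hfill (-1)%Z ltac:(lia)) as A1; pose proof (Hfill 1%Z ltac:(lia)) as A2.
  assert (A3 : letter i (-2) = beta i \/ letter i (-2) = letter (S i) (-1)).
  { destruct (Nat.eq_dec (n i) 2) as [E|E].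
    - right; rewrite <- M1, E; reflexivity.
    - left; apply Hfill; lia. }
  rewrite A1, A2 in N1; rewrite <- M0, A1.
  destruct (letter i 0), (beta i); intuition congruence. }
right; pose proof (Hfill 0%Z ltac:(lia)) as A0.
(* For [r = 1] and [n i = 2] the block is also the first one; for [n i] at least 4 the letters at
   -2, -1, 0 are all [beta i], against [N2]. For larger [r] below [n i - 1] the letters at -1, 0, 1
   are, against [N1]. *)
destruct (Z.eq_dec r 1) as [->|Hr1].
- destruct (Nat.eq_dec (n i) 2) as [E2|E2].
  + rewrite E2 in M1; simpl in M1.
    assert (A2' : letter i (-2) = beta i).
    { apply Hf; rewrite E2; intros [q Hq]; lia. }
    rewrite A0, A2' in N2; rewrite A0, M0 in N1; rewrite M0, M1, A0.
    rewrite M1 in N1, N2.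
    destruct (letter (S i) (-1)), (letter (S i) 0), (beta i); intuition congruence.
  + pose proof (Hfill (-1)%Z ltac:(lia)) as A1.
    rewrite A0, A1, M0 in N1; rewrite A0, A1 in N2.
    destruct (Nat.eq_dec (n i) 3) as [E3|E3].
    * rewrite E3 in M1; change (1 - Z.of_nat 3)%Z with (-2)%Z in M1; rewrite M1 in N2.
      left; destruct (letter (S i) (-1)), (letter (S i) 0), (beta i); intuition congruence.
    * pose proof (Hfill (-2)%Z ltac:(lia)) as A2; rewrite A2 in N2; tauto.
- pose proof (Hfill 1%Z ltac:(lia)) as A1; rewrite A0, A1 in N1.
  destruct (Z.eq_dec r (Z.of_nat (n i) - 1)) as [Er|Er].
  + replace (r - Z.of_nat (n i))%Z with (-1)%Z in M1 by lia.
    right; rewrite M1, A0, A1 in *.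
    destruct (letter (S i) (-1)), (beta i); intuition congruence.
  + pose proof (Hfill (-1)%Z ltac:(lia)) as A2; rewrite A2 in N1; tauto.
Qed.

(** * The gap between the two traces, and the contradiction *)

Definition gap (i : nat) : R := Cmod (ltr i true - ltr i false)%C.

Lemma gap_pos i : val true <> val false -> 0 < gap i.
Proof.
intros Hv; unfold gap; apply Cmod_gt_0; rewrite ltr_diff.
apply Cmult_neq_0; [|apply block_m11_neq_0].
intros E; apply Hv; replace (val true) with (val true - val false + val false)%C by ring.
rewrite E; ring.
Qed.

(** Write [x] for [ltr i (beta i)]. By [ltr_S_three] the new trace is affine in the old one with
    slope x^2 - 1. For the upper bound, the letter other than [beta (S i)] is [beta i], whose new
    trace is x^3 - 3x. *)
Lemma gap_S_three i : n i = 3%nat ->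
  (1 - Cmod (ltr i (beta i)) ^ 2) * gap i <= gap (S i) /\
  gap (S i) <= Cmod (ltr (S i) (beta (S i))) +
    (Cmod (ltr i (beta i)) ^ 2 + 3) * Cmod (ltr i (beta i)).
Proof.
intros Hn; unfold gap; split.
- rewrite !(ltr_S_three i _ Hn).
  set (x := ltr i (beta i)).
  replace ((x * x - 1) * ltr i true - 2 * x - ((x * x - 1) * ltr i false - 2 * x))%C
    with ((x * x - 1) * (ltr i true - ltr i false))%C by ring.
  rewrite Cmod_mult; apply Rmult_le_compat_r; [apply Cmod_ge_0|].
  pose proof (Cmod_sub_ge 1%C (x * x)%C) as E; rewrite Cmod_1, Cmod_mult in E.
  replace (x * x - 1)%C with (- (1 - x * x))%C by ring; rewrite Cmod_opp; simpl; lra.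
- assert (E : forall y z, Cmod (y - z)%C <= Cmod y + Cmod z).
  { intros y z; pose proof (Cmod_triangle y (- z)) as E; rewrite Cmod_opp in E; exact E. }
  assert (F : Cmod (ltr (S i) (beta i)) <=
    (Cmod (ltr i (beta i)) ^ 2 + 3) * Cmod (ltr i (beta i))).
  { rewrite (ltr_S_three i _ Hn); set (x := ltr i (beta i)).
    replace ((x * x - 1) * x - 2 * x)%C with (x * x * x - 3 * x)%C by ring.
    eapply Rle_trans; [apply E|]; rewrite !Cmod_mult, Cmod_R, Rabs_right by lra.
    simpl; lra. }
  eapply Rle_trans; [|apply Rplus_le_compat_l, F].
  rewrite (lv_beta HL).
  pose proof (E (ltr (S i) true) (ltr (S i) false)).
  destruct (beta i); simpl negb; lra.
Qed.

Lemma double_trace_bound i : double i ->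
  Cmod (ltr i (beta i)) * Cmod (psi t0) <=
  Cmod (psi (t0 + Z.of_nat (L i))%Z) + Cmod (psi (t0 - Z.of_nat (L i))%Z).
Proof.
intros [E1 E2]; pose proof (letter_rec i _ 0 E1 E2) as E.
apply gordon_lower.
replace (t0 + Z.of_nat (L i))%Z with (t0 + (0 + 1) * Z.of_nat (L i))%Z by lia.
replace (t0 - Z.of_nat (L i))%Z with (t0 + (0 - 1) * Z.of_nat (L i))%Z by lia.
rewrite E; do 2 f_equal; lia.
Qed.

(** Along such levels the traces [x_i] are square summable and the gap is multiplied by
    [|x_i^2 - 1|], so it stays away from 0; but it is controlled by [x_i] and [x_{i+1}]. *)
Lemma not_double_forever I : val true <> val false ->
  ~ (forall i, (I <= i)%nat -> double i /\ n i = 3%nat).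
Proof.
intros Hv HD.
pose proof (proj1 (Cmod_gt_0 _) Ht0) as P; set (k0 := Cmod (psi t0)) in *.
destruct (l2Z_tails psi H2) as [G [HG [Gm HT]]].
destruct (HT (k0 ^ 2 / 8)) as [N [HN [HTp HTm]]]; [nra|].
set (J := Nat.max I (Z.to_nat (N + Z.abs t0 + 1))).
assert (HJ : forall i, (J <= i)%nat -> (N + Z.abs t0 + 1 < Z.of_nat (L i))%Z)
  by (intros i Hi; pose proof (level_gt_index i); lia).
(* [s i] dominates the sum of the squared traces over levels [J] to [i - 1]: the values at distance
   [L j] from [t0] are absorbed by the mass at distances from [L j] up to, but excluding, [L (S j)].
   The 2 comes from (p + q)^2 <= 2 (p^2 + q^2). *)
set (s := fun i => 2 / k0 ^ 2 *
  ((G (t0 + Z.of_nat (L i) - 1)%Z - G (t0 + Z.of_nat (L J) - 1)%Z) +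
   (G (t0 - Z.of_nat (L J))%Z - G (t0 - Z.of_nat (L i))%Z))).
assert (K0 : 0 < 2 / k0 ^ 2) by (apply Rdiv_lt_0_compat; nra).
assert (Hs2 : forall i, (J <= i)%nat -> s i <= 1 / 2).
{ intros i Hi; pose proof (level_mono J i Hi); pose proof (HJ J (le_n J)).
  pose proof (HTp (t0 + Z.of_nat (L J) - 1)%Z (t0 + Z.of_nat (L i) - 1)%Z ltac:(lia)).
  pose proof (HTm (t0 - Z.of_nat (L i))%Z (t0 - Z.of_nat (L J))%Z ltac:(lia)).
  unfold s; replace (1 / 2) with (2 / k0 ^ 2 * (k0 ^ 2 / 8 + k0 ^ 2 / 8)) by (field; lra).
  apply Rmult_le_compat_l; lra. }
assert (Hx : forall i, (J <= i)%nat -> Cmod (ltr i (beta i)) ^ 2 <= s (S i) - s i).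
{ intros i Hi; destruct (HD i ltac:(lia)) as [Hdi _].
  pose proof (double_trace_bound i Hdi) as Hb; fold k0 in Hb.
  set (x := Cmod (ltr i (beta i))) in *.
  set (p := Cmod (psi (t0 + Z.of_nat (L i))%Z)) in *.
  set (q := Cmod (psi (t0 - Z.of_nat (L i))%Z)) in *.
  assert (0 <= x) by apply Cmod_ge_0.
  assert (0 <= p) by apply Cmod_ge_0. assert (0 <= q) by apply Cmod_ge_0.
  pose proof (level_double i); pose proof (level_pos i).
  pose proof (HG (t0 + Z.of_nat (L i))%Z) as G1; fold p in G1.
  pose proof (HG (t0 - Z.of_nat (L i))%Z) as G2; fold q in G2.
  pose proof (Gm (t0 + Z.of_nat (L i))%Z (t0 + Z.of_nat (L (S i)) - 1)%Z ltac:(lia)).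
  pose proof (Gm (t0 - Z.of_nat (L (S i)))%Z (t0 - Z.of_nat (L i) - 1)%Z ltac:(lia)).
  apply Rle_trans with (2 / k0 ^ 2 * (p ^ 2 + q ^ 2)).
  - apply (Rmult_le_reg_l (k0 ^ 2)); [nra|].
    replace (k0 ^ 2 * (2 / k0 ^ 2 * (p ^ 2 + q ^ 2))) with (2 * (p ^ 2 + q ^ 2))
      by (field; lra).
    assert ((x * k0) ^ 2 <= (p + q) ^ 2) by (apply pow_incr; nra).
    pose proof (pow2_ge_0 (p - q)); nra.
  - unfold s; rewrite <- Rmult_minus_distr_l; apply Rmult_le_compat_l; lra. }
assert (HsJ : s J = 0) by (unfold s; ring).
(* Weierstrass's inequality: a product of factors 1 - y_i is at least 1 minus the sum of the y_i. *)
assert (Hgap : forall m, 0 <= s (J + m)%nat /\ (1 - s (J + m)%nat) * gap J <= gap (J + m)).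
{ pose proof (gap_pos J Hv) as GJ.
  induction m as [|m [IH0 IH]]; [rewrite Nat.add_0_r, HsJ; lra|].
  rewrite Nat.add_succ_r.
  pose proof (Hx (J + m)%nat ltac:(lia)) as X1.
  pose proof (pow2_ge_0 (Cmod (ltr (J + m) (beta (J + m))))) as X0.
  pose proof (Hs2 (S (J + m)) ltac:(lia)).
  destruct (HD (J + m)%nat ltac:(lia)) as [_ Hn].
  destruct (gap_S_three (J + m) Hn) as [Hg _].
  set (y := Cmod (ltr (J + m) (beta (J + m))) ^ 2) in *.
  split; [lra|]; eapply Rle_trans; [|exact Hg].
  apply Rle_trans with ((1 - y) * ((1 - s (J + m)%nat) * gap J)).
  - assert (0 <= y * s (J + m)%nat * gap J); [|nra].
    apply Rmult_le_pos; [apply Rmult_le_pos|]; lra.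
  - apply Rmult_le_compat_l; lra. }
pose proof (gap_pos J Hv) as GJ.
(* Traces below [eta] bound a later gap by eta + 4 eta, at most 5/12 of [gap J], while the gap
   remains at least half of [gap J]. *)
set (eta := Rmin 1 (gap J / 12)).
assert (Heta : 0 < eta <= 1 /\ eta <= gap J / 12).
{ unfold eta; split; [split|]; [apply Rmin_glb_lt; lra|apply Rmin_l|apply Rmin_r]. }
destruct (decaying_solution (eta * k0 / 2)) as [M HM]; [nra|].
assert (Hsmall : forall i, (I <= i)%nat -> (M + Z.abs t0 <= Z.of_nat i)%Z ->
  Cmod (ltr i (beta i)) <= eta).
{ intros i Hi HMi; destruct (HD i Hi) as [Hdi _].
  pose proof (double_trace_bound i Hdi) as Hb; fold k0 in Hb.
  pose proof (level_gt_index i).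
  pose proof (HM (t0 + Z.of_nat (L i))%Z ltac:(lia)).
  pose proof (HM (t0 - Z.of_nat (L i))%Z ltac:(lia)).
  apply (Rmult_le_reg_r k0); lra. }
set (m := Z.to_nat (M + Z.abs t0)).
pose proof (Hsmall (J + m)%nat ltac:(lia) ltac:(lia)) as X1.
pose proof (Hsmall (S (J + m)) ltac:(lia) ltac:(lia)) as X2.
destruct (HD (J + m)%nat ltac:(lia)) as [_ Hn].
destruct (gap_S_three (J + m) Hn) as [_ Hg].
destruct (gap_S_three (J + m) Hn) as [Hg' _].
destruct (Hgap (S m)) as [_ Hl]; rewrite Nat.add_succ_r in Hl.
pose proof (Hs2 (S (J + m)) ltac:(lia)) as Hs3.
pose proof (Cmod_ge_0 (ltr (J + m) (beta (J + m)))) as X0.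
set (x := Cmod (ltr (J + m) (beta (J + m)))) in *.
assert ((x ^ 2 + 3) * x <= 4 * eta) by nra.
assert (1 / 2 * gap J <= (1 - s (S (J + m))) * gap J) by (apply Rmult_le_compat_r; lra).
lra.
Qed.

Lemma hierarchical_contradiction : val true <> val false -> False.
Proof.
intros Hv; destruct gordon_letters as [I HI].
(* The first and last cases of [letter_cases] put [beta (S i)], which differs from [beta i], next to
   [t0]. *)
assert (Hstep : forall i, (I <= i)%nat -> double i -> n i = 3%nat /\ double (S i)).
{ intros i Hi [D1 D2]; destruct (HI i Hi) as [N1 [N2 _]].
  pose proof (lv_beta HL i) as Hb.
  destruct (letter_cases i N1 N2) as [[E _]|[[E [E'|E']]|[_ [_ [E _]]]]].
  - rewrite E, Hb in D2; destruct (beta i); discriminate.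
  - auto.
  - contradiction.
  - rewrite E, Hb in D1; destruct (beta i); discriminate. }
assert (Hno : forall i, (I <= i)%nat -> ~ double i).
{ intros i Hi Hd; apply (not_double_forever i Hv).
  assert (Hall : forall j, (i <= j)%nat -> double j).
  { induction 1 as [|j Hj IH]; [exact Hd|]; apply (Hstep j); [lia|exact IH]. }
  intros j Hj; split; [now apply Hall|].
  apply (Hstep j); [lia|now apply Hall]. }
assert (Hcases : forall i, (I <= i)%nat ->
  (letter i 0 = beta (S i) /\ letter (S i) 0 = beta (S i) /\ letter i (-1) = beta i /\
     (letter i (-2) = beta i \/ letter i (-2) = letter (S i) (-1))) \/
  (letter i 0 = beta i /\ letter i 1 = beta i /\
     letter i (-1) = beta (S i) /\ letter (S i) (-1) = beta (S i))).
{ intros i Hi; destruct (HI i Hi) as [N1 [N2 _]].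
  destruct (letter_cases i N1 N2) as [E|[[E _]|E]]; auto.
  exfalso; apply (Hno (S i)); [lia|exact E]. }
(* Such a block is in first position at level [i], so in last position at level [S i] and in first
   position again one level up. This makes the letters at -1 and -2 of level [S i] equal, so the
   trace of [beta (S i)] is large there; the trace of [beta i] is large by [ltr_S_large]. *)
assert (Hrec : forall i, (I <= i)%nat -> letter i 0 = beta i -> False).
{ intros i Hi Hz.
  pose proof (lv_beta HL i) as B1.
  pose proof (lv_beta HL (S i)) as B2.
  destruct (Hcases i Hi) as [[E _]|[E0 [E1 [E2 E3]]]].
  { rewrite Hz, B1 in E; destruct (beta i); discriminate. }
  assert (Hn1 : letter (S i) 0 <> beta (S i)).
  { intros E; apply (Hno (S i)); [lia|split; assumption]. }
  destruct (Hcases (S i)) as [[F0 [F1 [F2 F3]]]|[F0 _]]; [lia| |contradiction].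
  destruct (Hcases (S (S i))) as [[K' _]|[_ [_ [K' _]]]]; [lia| |].
  { pose proof (lv_beta HL (S (S i))) as B3; rewrite F1, B3 in K'.
    destruct (beta (S (S i))); discriminate. }
  rewrite (lv_beta HL (S (S i))), B2, Bool.negb_involutive in K'.
  assert (F4 : letter (S i) (-1) = letter (S i) (-2)).
  { destruct F3 as [F3|F3]; rewrite F3; [exact F2|now rewrite K', F2]. }
  destruct (HI i Hi) as [_ [_ [T1 _]]].
  specialize (T1 ltac:(now rewrite E0, E1)); rewrite E0 in T1.
  destruct (HI (S i) ltac:(lia)) as [_ [_ [_ T2]]]; specialize (T2 F4); rewrite F2 in T2.
  apply (not_both_traces_large (S i)); intros e.
  destruct (Bool.bool_dec e (beta i)) as [->|He]; [now apply ltr_S_large|].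
  replace e with (beta (S i)); [exact T2|].
  rewrite B1; destruct e, (beta i); simpl; congruence. }
destruct (Hcases I (le_n I)) as [[_ [E _]]|[E _]].
- apply (Hrec (S I)); [lia|exact E].
- apply (Hrec I); [lia|exact E].
Qed.

End NoDecayingSolution.
End Levels.

(** * Vanishing of square summable solutions over a level structure *)

(** Needed when both letters have the same value. Multiples of [L] are periods too, so
    [gordon_three] applies at arbitrarily large distances. *)
Lemma periodic_decaying_zero v psi L : (1 <= L)%nat ->
  (forall t, v (t + Z.of_nat L)%Z = v t) -> solves v psi -> decays psi ->
  forall t, psi t = 0%C.
Proof.
intros HLpos Hv Hs Hd t; apply NNPP; intros Ht.
pose proof (proj1 (Cmod_gt_0 _) Ht) as P.
destruct (Hd (Cmod (psi t) / 4)) as [N HN]; [lra|].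
set (K := Z.to_nat (N + Z.abs t)).
assert (Em : exists m, S m = (S K * L)%nat) by (exists (S K * L - 1)%nat; nia).
destruct Em as [m Em].
assert (Hm : (S K <= S m)%nat) by nia.
assert (Hvm : forall s, v (s + Z.of_nat (S m))%Z = v s).
{ intros s; rewrite Em; clear m Em Hm; induction (S K) as [|k IH].
  - f_equal; lia.
  - replace (s + Z.of_nat (S k * L))%Z with (s + Z.of_nat (k * L) + Z.of_nat L)%Z by lia.
    rewrite Hv; exact IH. }
assert (R : forall s, (psi (s + Z.of_nat (S m))%Z + psi (s - Z.of_nat (S m))%Z =
  mtr (mon v (s - Z.of_nat (S m)) (S m)) * psi s)%C).
{ intros s; apply trace_recurrence; [exact Hs|]; intros i Hi.
  rewrite <- Hvm; f_equal; lia. }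
pose proof (R t) as R1; pose proof (R (t + Z.of_nat (S m))%Z) as R2.
replace (t + Z.of_nat (S m) - Z.of_nat (S m))%Z with t in R2 by lia.
rewrite (mon_ext v t (t - Z.of_nat (S m))) in R2
  by (intros i _; rewrite <- (Hvm (t - Z.of_nat (S m) + i)%Z); f_equal; lia).
pose proof (gordon_three _ _ _ _ _ R1 R2).
pose proof (HN (t + Z.of_nat (S m))%Z ltac:(lia)).
pose proof (HN (t - Z.of_nat (S m))%Z ltac:(lia)).
pose proof (HN (t + Z.of_nat (S m) + Z.of_nat (S m))%Z ltac:(lia)).
lra.
Qed.

Theorem levels_l2_zero v L h n beta c val psi :
  levels v L h n beta c val -> solves v psi -> l2Z psi -> forall t, psi t = 0%C.
Proof.
intros HL Hs H2 t; destruct (classic (val true = val false)) as [Hv|Hv].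
- apply (periodic_decaying_zero v psi (L O)); [apply HL| |exact Hs|now apply l2Z_decays].
  assert (Hc : forall e e', val e = val e') by (intros [] []; congruence).
  intros s; destruct (classic (Z.of_nat (L O) | s - h O)%Z) as [Hh|Hh]; [|now apply HL].
  rewrite !(lv_val HL); [apply Hc|exact Hh|].
  destruct Hh as [q Hq]; exists (q + 1)%Z; lia.
- apply NNPP; intros Ht.
  exact (hierarchical_contradiction v L h n beta c val HL psi Hs H2 t Ht Hv).
Qed.

(** * Letters of the Toeplitz words *)

Fixpoint level_len (nk : nat -> nat) (k : nat) : nat :=
  match k with O => 1%nat | S k' => (nk k' * level_len nk k')%nat end.

Lemma level_len_pos nk : (forall k, (2 <= nk k)%nat) -> forall k, (1 <= level_len nk k)%nat.
Proof. intros Hn; induction k as [|k IH]; simpl; [lia|]; specialize (Hn k); nia. Qed.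

Lemma level_len_ge nk : (forall k, (2 <= nk k)%nat) -> forall k, (k < level_len nk k)%nat.
Proof.
intros Hn; induction k as [|k IH]; simpl; [lia|]; specialize (Hn k); nia.
Qed.

Lemma level_len_divide nk j k : (j <= k)%nat -> Nat.divide (level_len nk j) (level_len nk k).
Proof.
induction 1 as [|k Hk IH]; [apply Nat.divide_refl|].
simpl; now apply Nat.divide_mul_r.
Qed.

Lemma nth_concat_repeat (w : list R) m i : (i < m * length w)%nat ->
  nth i (concat (repeat w m)) 0 = nth (i mod length w) w 0.
Proof.
revert i; induction m as [|m IH]; intros i Hi; [simpl in Hi; lia|].
simpl; destruct (lt_dec i (length w)) as [H|H].
- now rewrite app_nth1, Nat.mod_small.
- rewrite app_nth2, IH by (simpl in Hi; lia).
  f_equal; replace i with (i - length w + 1 * length w)%nat at 2 by lia.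
  now rewrite Nat.Div0.mod_add.
Qed.

Lemma length_concat_repeat (w : list R) m : length (concat (repeat w m)) = (m * length w)%nat.
Proof. induction m as [|m IH]; [reflexivity|]; simpl; rewrite length_app, IH; reflexivity. Qed.

Lemma toep_word_length bk nk : (forall k, (2 <= nk k)%nat) ->
  forall k, length (toep_word bk nk k) = level_len nk k.
Proof.
intros Hn; induction k as [|k IH]; [reflexivity|]; simpl.
rewrite length_app, removelast_firstn_len, length_firstn, length_concat_repeat, IH; simpl.
pose proof (level_len_pos nk Hn k); specialize (Hn k); nia.
Qed.

Lemma toep_word_nth_S bk nk : (forall k, (2 <= nk k)%nat) -> forall k i,
  (i + 1 < level_len nk (S k))%nat ->
  nth i (toep_word bk nk (S k)) 0 = nth (i mod level_len nk k) (toep_word bk nk k) 0.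
Proof.
intros Hn k i Hi; cbn [toep_word].
assert (E : length (concat (repeat (toep_word bk nk k) (nk k))) = level_len nk (S k))
  by (rewrite length_concat_repeat, toep_word_length by exact Hn; reflexivity).
rewrite app_nth1 by (rewrite removelast_firstn_len, length_firstn, E; lia).
rewrite removelast_firstn_len, E, nth_firstn.
replace (i <? pred (level_len nk (S k)))%nat with true
  by (symmetry; apply Nat.ltb_lt; lia).
rewrite nth_concat_repeat; rewrite toep_word_length by exact Hn; [reflexivity|].
simpl in Hi; lia.
Qed.

Lemma toep_word_last bk nk : (forall k, (2 <= nk k)%nat) -> forall k,
  nth (level_len nk k - 1) (toep_word bk nk k) 0 = bk k.
Proof.
intros Hn [|k]; [reflexivity|]; cbn [toep_word].
assert (E : length (removelast (concat (repeat (toep_word bk nk k) (nk k)))) =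
  (level_len nk (S k) - 1)%nat).
{ rewrite removelast_firstn_len, length_firstn, length_concat_repeat, toep_word_length
    by exact Hn; simpl; lia. }
rewrite app_nth2, E, Nat.sub_diag by lia; reflexivity.
Qed.

(** Reduce [i] modulo shorter and shorter words until it is the last index of word [j]. Divisibility
    concerns [i + 1] because the replaced letter stands at the end of each word. *)
Lemma toep_word_nth bk nk : (forall k, (2 <= nk k)%nat) -> forall k i j,
  (i < level_len nk k)%nat -> (j < k)%nat ->
  Nat.divide (level_len nk j) (i + 1) -> ~ Nat.divide (level_len nk (S j)) (i + 1) ->
  nth i (toep_word bk nk k) 0 = bk j.
Proof.
intros Hn; induction k as [|k IH]; intros i j Hi Hj Hd Hnd; [lia|].
assert (Hi' : (i + 1 < level_len nk (S k))%nat).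
{ enough (i + 1 <> level_len nk (S k))%nat by lia.
  intros E; apply Hnd; rewrite E; now apply level_len_divide. }
rewrite toep_word_nth_S by assumption.
pose proof (level_len_pos nk Hn k) as Hp.
pose proof (Nat.div_mod_eq i (level_len nk k)) as E.
pose proof (Nat.mod_upper_bound i (level_len nk k) ltac:(lia)) as Hm.
destruct (Nat.eq_dec j k) as [->|Hne].
- replace (i mod level_len nk k)%nat with (level_len nk k - 1)%nat;
    [now apply toep_word_last|].
  destruct Hd as [q Hq].
  assert (q = i / level_len nk k + 1)%nat by nia; nia.
- assert (E' : (i + 1 = level_len nk k * (i / level_len nk k) + (i mod level_len nk k + 1))%nat)
    by lia.
  apply IH; [exact Hm|lia| |].
  + apply (Nat.divide_add_cancel_r _ (level_len nk k * (i / level_len nk k)));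
      [|now rewrite <- E'].
    apply Nat.divide_mul_l, level_len_divide; lia.
  + intros Hd'; apply Hnd; rewrite E'; apply Nat.divide_add_r; [|exact Hd'].
    apply Nat.divide_mul_l, level_len_divide; lia.
Qed.

Lemma toep_limit_eq bk nk : (forall k, (2 <= nk k)%nat) -> forall i j,
  Nat.divide (level_len nk j) (i + 1) -> ~ Nat.divide (level_len nk (S j)) (i + 1) ->
  toep_limit bk nk i = bk j.
Proof.
intros Hn i j Hd Hnd; unfold toep_limit.
pose proof (level_len_ge nk Hn i); pose proof (level_len_ge nk Hn j).
assert (level_len nk j <= i + 1)%nat by (apply Nat.divide_pos_le; [lia|exact Hd]).
destruct (lt_dec j i) as [Hj|Hj]; [now apply toep_word_nth|].
(* In this case word [i] has length exactly [i + 1], and its last letter is read. *)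
assert (j = i) as -> by lia.
rewrite <- toep_word_last with (nk := nk) by exact Hn; f_equal; lia.
Qed.

(** * Hole positions in points of the subshift *)

Lemma finite_pigeonhole (m : nat) (P : nat -> nat -> Prop) :
  (forall j N M, (N <= M)%nat -> P j M -> P j N) ->
  (forall N, exists j, (j < m)%nat /\ P j N) ->
  exists j, (j < m)%nat /\ forall N, P j N.
Proof.
intros Hanti; induction m as [|m IH]; intros HP.
- destruct (HP O) as [j [Hj _]]; lia.
- destruct (classic (forall N, P m N)) as [Hm|Hm]; [exists m; split; [lia|exact Hm]|].
  apply not_all_ex_not in Hm; destruct Hm as [N0 HN0].
  destruct IH as [j [Hj HPj]]; [|exists j; split; [lia|exact HPj]].
  intros N; destruct (HP (Nat.max N N0)) as [j [Hj HPj]].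
  exists j; split; [|apply (Hanti j N (Nat.max N N0)); [lia|exact HPj]].
  enough (j <> m) by lia; intros ->.
  apply HN0, (Hanti m N0 (Nat.max N N0)); [lia|exact HPj].
Qed.

Lemma dependent_choice_nat (T : Type) (P : nat -> T -> Prop) (R : nat -> T -> T -> Prop) (t0 : T) :
  P O t0 -> (forall k t, P k t -> exists t', P (S k) t' /\ R k t t') ->
  exists f : nat -> T, f O = t0 /\ forall k, P k (f k) /\ R k (f k) (f (S k)).
Proof.
intros H0 HS.
set (next := fun k (s : {t | P k t}) =>
  constructive_indefinite_description _ (HS k (proj1_sig s) (proj2_sig s))).
set (g := fix g (k : nat) : {t | P k t} :=
  match k with
  | O => exist _ t0 H0
  | S k' => exist _ (proj1_sig (next k' (g k'))) (proj1 (proj2_sig (next k' (g k'))))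
  end).
exists (fun k => proj1_sig (g k)); split; [reflexivity|]; intros k.
split; [apply (proj2_sig (g k))|exact (proj2 (proj2_sig (next k (g k))))].
Qed.

(** [h k] is a position of a hole of level [k]; the holes of level [k] that are not holes
    of level [k+1] are filled with [bk k]. *)
Definition skeleton (bk : nat -> R) (nk : nat -> nat) (x : Z -> R) (h : nat -> Z) : Prop :=
  (forall k, (Z.of_nat (level_len nk k) | h (S k) - h k)%Z) /\
  (forall k t, (Z.of_nat (level_len nk k) | t - h k)%Z ->
     ~ (Z.of_nat (level_len nk (S k)) | t - h (S k))%Z -> x t = bk k).

Lemma subshift_window bk nk x : (forall k, (2 <= nk k)%nat) -> toeplitz_subshift bk nk x ->
  forall N : nat, exists r, forall k t, (Z.abs t <= Z.of_nat N)%Z ->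
    (Z.of_nat (level_len nk k) | t - r)%Z ->
    ~ (Z.of_nat (level_len nk (S k)) | t - r)%Z -> x t = bk k.
Proof.
intros Hn Hx N; destruct (Hx (- Z.of_nat N)%Z (Z.of_nat N) ltac:(lia)) as [m Hm].
(* This site corresponds to index -1 of the one-sided limit, so that [t - r] is the index of the
   letter plus 1. *)
exists (- Z.of_nat N - Z.of_nat m - 1)%Z; intros k t Ht Hd Hnd.
pose proof (Hm (Z.to_nat (t + Z.of_nat N)) ltac:(lia)) as E.
replace (- Z.of_nat N + Z.of_nat (Z.to_nat (t + Z.of_nat N)))%Z with t in E by lia.
rewrite E; apply toep_limit_eq; [exact Hn| |].
- destruct Hd as [q Hq]; exists (Z.to_nat q).
  assert (0 <= q)%Z by nia; nia.
- intros [q Hq]; apply Hnd; exists (Z.of_nat q); nia.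
Qed.

(** A compactness argument: a residue of level [k] compatible with all finite windows has one of its
    [nk k] refinements compatible with all of them, and these refinements are chosen
    successively. *)
Lemma skeleton_exists bk nk x : (forall k, (2 <= nk k)%nat) -> toeplitz_subshift bk nk x ->
  exists h, skeleton bk nk x h.
Proof.
intros Hn Hx.
set (win := fun (N : nat) r => forall k t, (Z.abs t <= Z.of_nat N)%Z ->
    (Z.of_nat (level_len nk k) | t - r)%Z ->
    ~ (Z.of_nat (level_len nk (S k)) | t - r)%Z -> x t = bk k).
set (adm := fun k r (N : nat) => exists r', (Z.of_nat (level_len nk k) | r' - r)%Z /\ win N r').
destruct (dependent_choice_nat Z (fun k r => forall N, adm k r N)
  (fun k r r' => (Z.of_nat (level_len nk k) | r' - r)%Z) 0%Z) as [h [_ Hh]].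
- intros N; destruct (subshift_window bk nk x Hn Hx N) as [r Hr].
  exists r; split; [exists (r - 0)%Z; simpl; lia|exact Hr].
- intros k r Hr.
  destruct (finite_pigeonhole (nk k)
    (fun j N => adm (S k) (r + Z.of_nat j * Z.of_nat (level_len nk k))%Z N)) as [j [_ Hj]].
  + intros j N M HNM [r' [Hd Hw]]; exists r'; split; [exact Hd|].
    intros i t Ht; apply Hw; lia.
  + intros N; destruct (Hr N) as [r' [[q Hq] Hw]].
    specialize (Hn k).
    pose proof (Z.mod_pos_bound q (Z.of_nat (nk k)) ltac:(lia)) as Hmod.
    pose proof (Z.div_mod q (Z.of_nat (nk k)) ltac:(lia)) as Hdm.
    exists (Z.to_nat (q mod Z.of_nat (nk k))); split; [lia|].
    exists r'; split; [|exact Hw].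
    exists (q / Z.of_nat (nk k))%Z; cbn [level_len].
    rewrite Z2Nat.id, Nat2Z.inj_mul by lia; rewrite Hdm in Hq at 1; lia.
  + exists (r + Z.of_nat j * Z.of_nat (level_len nk k))%Z; split; [exact Hj|].
    exists (Z.of_nat j); lia.
- exists h; split; [intros k; apply Hh|]; intros k t Hd Hnd.
  destruct (Hh (S k)) as [Ha _]; destruct (Ha (Z.to_nat (Z.abs t))) as [r' [Hr' Hw]].
  destruct (Hh k) as [_ Hk].
  apply Hw; [lia| |].
  + replace (t - r')%Z with ((t - h k) - (h (S k) - h k) - (r' - h (S k)))%Z by lia.
    apply Z.divide_sub_r; [apply Z.divide_sub_r; assumption|].
    eapply Z.divide_trans; [|exact Hr']; exists (Z.of_nat (nk k)); simpl; lia.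
  + intros Hd'; apply Hnd.
    replace (t - h (S k))%Z with ((t - r') + (r' - h (S k)))%Z by lia.
    now apply Z.divide_add_r.
Qed.

(** * Recurrence of letters and periodicity off the holes *)

Lemma coding_recurs a b bk nk : coding_ok a b bk nk -> forall K e, e = a \/ e = b ->
  exists k, (K <= k)%nat /\ bk k = e.
Proof.
intros [Hab [_ Hnc]] K e He; apply NNPP; intros Hno; apply Hnc; exists K; intros k Hk.
assert (H1 : bk k <> e) by (intros E; apply Hno; now exists k).
assert (H3 : bk K <> e) by (intros E; apply Hno; exists K; split; [lia|exact E]).
destruct (Hab k), (Hab K), He; congruence.
Qed.

Lemma next_change a b bk nk : coding_ok a b bk nk -> forall k,
  exists k', (k < k')%nat /\ bk k' <> bk k /\ forall j, (k <= j < k')%nat -> bk j = bk k.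
Proof.
intros [_ [_ Hnc]] k.
assert (Hex : exists k', (k < k')%nat /\ bk k' <> bk k).
{ apply NNPP; intros Hno; apply Hnc; exists k; intros j Hj.
  apply NNPP; intros E; apply Hno; exists j; split; [|exact E].
  enough (j <> k) by lia; congruence. }
destruct Hex as [k' Hk']; revert Hk'.
induction k' as [k' IH] using lt_wf_ind; intros [Hlt Hne].
destruct (classic (exists j, (k < j < k')%nat /\ bk j <> bk k)) as [[j [Hj Ej]]|Hno].
- apply (IH j); [lia|split; [lia|exact Ej]].
- exists k'; split; [exact Hlt|split; [exact Hne|]]; intros j Hj.
  apply NNPP; intros E; apply Hno; exists j; split; [|exact E].
  enough (j <> k) by lia; congruence.
Qed.

Lemma subshift_letters a b bk nk x : coding_ok a b bk nk -> toeplitz_subshift bk nk x ->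
  forall t, x t = a \/ x t = b.
Proof.
intros [Hab [Hn _]] Hx t; destruct (Hx t t ltac:(lia)) as [m Hm].
specialize (Hm O ltac:(lia)); rewrite Z.add_0_r, Nat.add_0_r in Hm; rewrite Hm.
assert (Hj : exists j, Nat.divide (level_len nk j) (m + 1) /\
  ~ Nat.divide (level_len nk (S j)) (m + 1)).
{ apply NNPP; intros Hno.
  assert (Hall : forall j, Nat.divide (level_len nk j) (m + 1)).
  { induction j as [|j IH]; [exists (m + 1)%nat; simpl; lia|].
    apply NNPP; intros Hd; apply Hno; now exists j. }
  pose proof (level_len_ge nk Hn (m + 1)).
  assert (level_len nk (m + 1) <= m + 1)%nat by (apply Nat.divide_pos_le; [lia|apply Hall]).
  lia. }
destruct Hj as [j [H1 H3]]; rewrite (toep_limit_eq bk nk Hn m j H1 H3); apply Hab.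
Qed.

Lemma level_len_divide_Z nk j k : (j <= k)%nat ->
  (Z.of_nat (level_len nk j) | Z.of_nat (level_len nk k))%Z.
Proof.
intros H; destruct (level_len_divide nk j k H) as [q Hq]; exists (Z.of_nat q); lia.
Qed.

Lemma skeleton_nested bk nk x h : skeleton bk nk x h -> forall j k, (j <= k)%nat ->
  (Z.of_nat (level_len nk j) | h k - h j)%Z.
Proof.
intros [Hh _] j k; induction 1 as [|k Hk IH]; [rewrite Z.sub_diag; apply Z.divide_0_r|].
replace (h (S k) - h j)%Z with ((h (S k) - h k) + (h k - h j))%Z by lia.
apply Z.divide_add_r; [|exact IH].
eapply Z.divide_trans; [apply level_len_divide_Z, Hk|apply Hh].
Qed.

Lemma skeleton_fill_between nk (h : nat -> Z) i k t : (i <= k)%nat ->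
  (Z.of_nat (level_len nk i) | t - h i)%Z -> ~ (Z.of_nat (level_len nk k) | t - h k)%Z ->
  exists j, (i <= j < k)%nat /\ (Z.of_nat (level_len nk j) | t - h j)%Z /\
    ~ (Z.of_nat (level_len nk (S j)) | t - h (S j))%Z.
Proof.
intros Hik Hi; induction Hik as [|k Hk IH]; intros Hnd; [contradiction|].
destruct (classic (Z.of_nat (level_len nk k) | t - h k)%Z) as [Hd|Hd].
- exists k; split; [lia|split; assumption].
- destruct (IH Hd) as [j [Hj Hj']]; exists j; split; [lia|exact Hj'].
Qed.

Lemma skeleton_periodic bk nk x h : skeleton bk nk x h -> forall k t s,
  ~ (Z.of_nat (level_len nk k) | t - h k)%Z ->
  (Z.of_nat (level_len nk k) | s - t)%Z -> x s = x t.
Proof.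
intros Hsk k t s Hnd Hst.
destruct (skeleton_fill_between nk h O k t ltac:(lia)) as [j [Hj [Hd Hnd']]];
  [exists (t - h O)%Z; simpl; lia|exact Hnd|].
destruct Hsk as [_ Hfill]; rewrite (Hfill j t Hd Hnd'); apply Hfill.
- replace (s - h j)%Z with ((s - t) + (t - h j))%Z by lia.
  apply Z.divide_add_r; [|exact Hd].
  eapply Z.divide_trans; [|exact Hst]; apply level_len_divide_Z; lia.
- intros Hd'; apply Hnd'.
  replace (t - h (S j))%Z with ((s - h (S j)) - (s - t))%Z by lia.
  apply Z.divide_sub_r; [exact Hd'|].
  eapply Z.divide_trans; [|exact Hst]; apply level_len_divide_Z; lia.
Qed.

(** Take levels [k < k'] that both use [e]. The site [q'] is filled at level [k'], and the site
    [level_len nk k] to its left is filled at level [k]. *)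
Lemma equal_holes a b bk nk x h : coding_ok a b bk nk -> skeleton bk nk x h ->
  forall K e, e = a \/ e = b -> exists k q, (K <= k)%nat /\
    (Z.of_nat (level_len nk K) | q - h K)%Z /\ x q = e /\
    x (q + Z.of_nat (level_len nk k))%Z = e.
Proof.
intros Hc Hsk K e He.
destruct (coding_recurs a b bk nk Hc K e He) as [k [Hk Ek]].
destruct (coding_recurs a b bk nk Hc (S k) e He) as [k' [Hk' Ek']].
destruct Hc as [_ [Hn _]].
pose proof (level_len_pos nk Hn k) as Pk; pose proof (level_len_pos nk Hn k') as Pk'.
pose proof (Hn k) as Nk; pose proof (Hn k') as Nk'.
set (q' := (h (S k') + Z.of_nat (level_len nk k'))%Z).
assert (D : forall j, (j <= k')%nat -> (Z.of_nat (level_len nk j) | q' - h j)%Z).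
{ intros j Hj; unfold q'.
  replace (h (S k') + Z.of_nat (level_len nk k') - h j)%Z
    with ((h (S k') - h j) + Z.of_nat (level_len nk k'))%Z by lia.
  apply Z.divide_add_r; [|now apply level_len_divide_Z].
  apply (skeleton_nested bk nk x h Hsk); lia. }
assert (Dk : forall j, (j <= k)%nat ->
  (Z.of_nat (level_len nk j) | q' - Z.of_nat (level_len nk k) - h j)%Z).
{ intros j Hj.
  replace (q' - Z.of_nat (level_len nk k) - h j)%Z
    with ((q' - h j) - Z.of_nat (level_len nk k))%Z by lia.
  apply Z.divide_sub_r; [apply D; lia|now apply level_len_divide_Z]. }
exists k, (q' - Z.of_nat (level_len nk k))%Z; split; [exact Hk|split; [|split]].
- now apply Dk.
- rewrite <- Ek; apply Hsk; [now apply Dk|]; intros Hd.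
  destruct (D (S k) Hk') as [u Hu]; destruct Hd as [w Hw]; cbn [level_len] in Hu, Hw.
  assert (Hd' : (Z.of_nat (level_len nk (S k)) | Z.of_nat (level_len nk k))%Z)
    by (exists (u - w)%Z; cbn [level_len]; lia).
  apply Z.divide_pos_le in Hd'; [|lia]; cbn [level_len] in Hd'; nia.
- replace (q' - Z.of_nat (level_len nk k) + Z.of_nat (level_len nk k))%Z with q' by lia.
  rewrite <- Ek'; apply Hsk; [now apply D|]; unfold q'.
  replace (h (S k') + Z.of_nat (level_len nk k') - h (S k'))%Z
    with (Z.of_nat (level_len nk k')) by lia.
  intros Hd; apply Z.divide_pos_le in Hd; [|lia]; cbn [level_len] in Hd; nia.
Qed.

Lemma subshift_shift bk nk x m : toeplitz_subshift bk nk x ->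
  toeplitz_subshift bk nk (shiftZ m x).
Proof.
intros Hx j k Hjk; destruct (Hx (j + m)%Z (k + m)%Z ltac:(lia)) as [m' Hm'].
exists m'; intros t Ht; unfold shiftZ.
replace (j + Z.of_nat t + m)%Z with (j + m + Z.of_nat t)%Z by lia; apply Hm'; lia.
Qed.

(** * Cyclic factors and level lengths *)

(** If a point and its shift by [L] both look like [x] near the origin, then [L] is 0
    modulo [p]; such a point is found by moving the hole of [x] in the window to a hole
    whose letter recurs at distance [L]. *)
Lemma factor_divides_level a b bk nk x p : coding_ok a b bk nk ->
  toeplitz_subshift bk nk x -> Zp_factor (toeplitz_subshift bk nk) p ->
  exists k, (p | Z.of_nat (level_len nk k))%Z.
Proof.
intros Hc Hx [pi [Hrange [_ [Hshift Hcont]]]].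
pose proof (proj1 (proj2 Hc)) as Hn.
destruct (skeleton_exists bk nk x Hn Hx) as [h Hsk].
destruct (Hcont x Hx) as [N HN].
(* Holes of level [K] are more than [2 * N + 1] apart, so the window contains at most one, and [H]
   is the first at or after [- N]. *)
set (K := (2 * N + 1)%nat); pose proof (level_len_ge nk Hn K) as HK.
pose proof (Z.mod_pos_bound (h K + Z.of_nat N) (Z.of_nat (level_len nk K)) ltac:(lia)) as Hmb.
pose proof (Z.div_mod (h K + Z.of_nat N) (Z.of_nat (level_len nk K)) ltac:(lia)) as Hdm.
set (H := (- Z.of_nat N + (h K + Z.of_nat N) mod Z.of_nat (level_len nk K))%Z).
assert (HH : (Z.of_nat (level_len nk K) | H - h K)%Z).
{ exists (- ((h K + Z.of_nat N) / Z.of_nat (level_len nk K)))%Z; unfold H; lia. }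
destruct (equal_holes a b bk nk x h Hc Hsk K (x H) (subshift_letters a b bk nk x Hc Hx H))
  as [k [q [Hk [Hq [E1 E2]]]]].
exists k; set (l := Z.of_nat (level_len nk k)) in *.
assert (Hagree : forall y, (Z.of_nat (level_len nk K) | y - h K)%Z -> x y = x H ->
  pi (shiftZ (y - H) x) = pi x).
{ intros y Hy Ey; apply HN; [now apply subshift_shift|]; intros t Ht; unfold shiftZ.
  destruct (Z.eq_dec t H) as [->|Hne]; [rewrite <- Ey; f_equal; lia|].
  apply (skeleton_periodic bk nk x h Hsk K).
  - intros Hd; assert (Hd' : (Z.of_nat (level_len nk K) | t - H)%Z).
    { replace (t - H)%Z with ((t - h K) - (H - h K))%Z by lia; now apply Z.divide_sub_r. }
    apply Z.divide_abs_r, Z.divide_pos_le in Hd'; unfold H in *; lia.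
  - replace (t + (y - H) - t)%Z with ((y - h K) - (H - h K))%Z by lia.
    now apply Z.divide_sub_r. }
pose proof (Hagree q Hq E1) as A1.
assert (A2 : pi (shiftZ (q + l - H) x) = pi x).
{ apply Hagree; [|exact E2].
  replace (q + l - h K)%Z with ((q - h K) + l)%Z by lia.
  apply Z.divide_add_r; [exact Hq|]; unfold l; now apply level_len_divide_Z. }
assert (Hp : (0 < p)%Z) by (specialize (Hrange x Hx); lia).
assert (Hiter : forall m : nat, pi (shiftZ (q + Z.of_nat m - H) x) =
  ((pi (shiftZ (q - H) x) + Z.of_nat m) mod p)%Z).
{ induction m as [|m IH].
  - rewrite !Z.add_0_r; symmetry; apply Z.mod_small, Hrange; now apply subshift_shift.
  - replace (shiftZ (q + Z.of_nat (S m) - H) x)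
      with (shiftZ 1 (shiftZ (q + Z.of_nat m - H) x))
      by (apply functional_extensionality; intros t; unfold shiftZ; f_equal; lia).
    rewrite Hshift by now apply subshift_shift.
    rewrite IH, Z.add_mod_idemp_l by lia; f_equal; lia. }
pose proof (Hiter (level_len nk k)) as E; fold l in E; rewrite A1, A2 in E.
pose proof (Z.div_mod (pi x + l) p ltac:(lia)) as Ed.
exists ((pi x + l) / p)%Z; lia.
Qed.

(** * From the operator to a level structure *)

Theorem theorem1p3
  (a b : R) (hab : a <> b)
  (bk : nat -> R) (nk : nat -> nat) (hs : coding_ok a b bk nk)
  (n0 : Z) (g : R -> R)
  (p : Z) (hp : (1 <= p)%Z)
  (Vper : Z -> R) (hper : forall m : Z, Vper (m + p)%Z = Vper m)
  (hfactor : Zp_factor (toeplitz_subshift bk nk) p) :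
  let f1 := fun x : Z -> R => g (x n0) in
  forall x : Z -> R, toeplitz_subshift bk nk x ->
    forall E : C, ~ is_eigenvalue (fun m : Z => f1 (shiftZ m x) + Vper m) E.
Proof.
intros f1 x Hx E [psi [H2 [[t1 Ht1] Heq]]].
pose proof (proj1 (proj2 hs)) as Hn.
destruct (skeleton_exists bk nk x Hn Hx) as [h Hsk].
destruct (factor_divides_level a b bk nk x p hs Hx hfactor) as [k0 Hk0].
(* [kap] lists the levels at which the letter changes, starting at [k0], where [p] already divides
   the level length. *)
destruct (dependent_choice_nat nat (fun _ _ => True)
  (fun _ k k' => (k < k')%nat /\ bk k' <> bk k /\ forall j, (k <= j < k')%nat -> bk j = bk k) k0)
  as [kap [Hkap0 Hkap]]; [exact I| |].
{ intros _ k _; destruct (next_change a b bk nk hs k) as [k' Hk']; now exists k'. }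
assert (HVper : forall m k, Vper (m + k * Z.of_nat (level_len nk k0))%Z = Vper m).
{ assert (Hpn : forall (j : nat) m, Vper (m + Z.of_nat j * p)%Z = Vper m).
  { induction j as [|j IH]; intros m; [now rewrite Z.add_0_r|].
    replace (m + Z.of_nat (S j) * p)%Z with (m + Z.of_nat j * p + p)%Z by lia.
    rewrite hper; apply IH. }
  destruct Hk0 as [w Hw]; intros m k; rewrite Hw.
  destruct (Z_le_gt_dec 0 (k * w)).
  - rewrite <- (Hpn (Z.to_nat (k * w)) m); f_equal; lia.
  - rewrite <- (Hpn (Z.to_nat (- (k * w))) (m + k * (w * p))%Z); f_equal; lia. }
set (is_a := fun r : R => if Req_EM_T r a then true else false).
set (v := fun t : Z => (E - RtoC (f1 (shiftZ t x) + Vper t))%C).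
(* The potential at [t] reads [x] at [t + n0], so the holes move by [- n0]. On the holes of level
   [k0] the periodic part is constant, equal to [Vper (h k0 - n0)]. *)
apply Ht1; apply (levels_l2_zero v
  (fun i => level_len nk (kap i)) (fun i => h (kap i) - n0)%Z
  (fun i => level_len nk (kap (S i)) / level_len nk (kap i))%nat
  (fun i => is_a (bk (kap i))) (fun t => is_a (x (t + n0)%Z))
  (fun e : bool => (E - RtoC (g (if e then a else b) + Vper (h k0 - n0)%Z))%C)); [|  |exact H2].
- assert (Hratio : forall i, exists q, (2 <= q)%nat /\
    level_len nk (kap (S i)) = (q * level_len nk (kap i))%nat).
  { intros i; destruct (Hkap i) as [_ [Hlt _]].
    destruct (level_len_divide nk (S (kap i)) (kap (S i)) Hlt) as [q Hq].
    exists (q * nk (kap i))%nat; specialize (Hn (kap i)).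
    pose proof (level_len_pos nk (proj1 (proj2 hs)) (kap (S i))).
    assert (q <> 0)%nat by (intros ->; simpl in Hq; lia).
    split; [nia|rewrite Hq; simpl; lia]. }
  assert (Hdiv : forall i, exists q, (2 <= q)%nat /\
    level_len nk (kap (S i)) = (q * level_len nk (kap i))%nat /\
    (level_len nk (kap (S i)) / level_len nk (kap i))%nat = q).
  { intros i; destruct (Hratio i) as [q [Hq Eq]]; exists q; split; [exact Hq|split; [exact Eq|]].
    rewrite Eq; apply Nat.div_mul; pose proof (level_len_pos nk Hn (kap i)); lia. }
  split; cbv beta.
  + apply level_len_pos, Hn.
  + intros i; destruct (Hdiv i) as [q [Hq [_ ->]]]; exact Hq.
  + intros i; destruct (Hdiv i) as [q [_ [Eq ->]]]; exact Eq.
  + intros i; replace (h (kap (S i)) - n0 - (h (kap i) - n0))%Z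
      with (h (kap (S i)) - h (kap i))%Z by lia.
    apply (skeleton_nested bk nk x h Hsk); apply Nat.lt_le_incl, Hkap.
  + intros i; destruct (Hkap i) as [_ [_ [Hne _]]]; unfold is_a.
    destruct (proj1 hs (kap i)), (proj1 hs (kap (S i))),
      (Req_EM_T (bk (kap i)) a), (Req_EM_T (bk (kap (S i))) a); simpl; congruence.
  + intros t Ht; rewrite Hkap0 in *; unfold v; do 3 f_equal.
    * unfold f1, shiftZ; f_equal; apply (skeleton_periodic bk nk x h Hsk k0).
      -- intros Hd; apply Ht; replace (t - (h k0 - n0))%Z with (n0 + t - h k0)%Z by lia; exact Hd.
      -- exists 1%Z; lia.
    * rewrite <- (HVper t 1%Z); f_equal; lia.
  + intros t [q Hq]; rewrite Hkap0 in Hq; unfold v; do 3 f_equal.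
    * unfold f1, shiftZ, is_a; rewrite (Z.add_comm n0 t); f_equal.
      destruct (Req_EM_T (x (t + n0)%Z) a) as [e|e]; [exact e|].
      destruct (subshift_letters a b bk nk x hs Hx (t + n0)%Z); congruence.
    * rewrite <- (HVper (h k0 - n0)%Z q); f_equal; lia.
  (* The site is filled at some level from [kap i] up to, but excluding, [kap (S i)], a range on
     which [bk] is constant. *)
  + intros i t Hd Hnd; f_equal.
    destruct (Hkap i) as [_ [Hlt [_ Hconst]]].
    replace (t - (h (kap i) - n0))%Z with (t + n0 - h (kap i))%Z in Hd by lia.
    replace (t - (h (kap (S i)) - n0))%Z with (t + n0 - h (kap (S i)))%Z in Hnd by lia.
    destruct (skeleton_fill_between nk h (kap i) (kap (S i)) (t + n0)%Z
      (Nat.lt_le_incl _ _ Hlt) Hd Hnd) as [j [Hj [Hjd Hjnd]]].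
    rewrite <- (Hconst j Hj); now apply Hsk.
- intros t; unfold v; specialize (Heq t).
  transitivity (psi (t + 1)%Z + psi (t - 1)%Z + RtoC (f1 (shiftZ t x) + Vper t) * psi t
    - psi (t - 1)%Z - RtoC (f1 (shiftZ t x) + Vper t) * psi t)%C; [ring|].
  rewrite Heq; ring.
Qed.
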